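(* Let $\{\gamma_{ij}:\mathbb{R}\to\mathbb{R}\}_{i,j\in\{1,\dots,p\},\, i\neq j}$ be a connected interconnection all of whose functions $\gamma_{ij}$ are locally Lipschitz. For $\omega>0$ consider the system $\dot{\mathbf{x}}=\gamma(\mathbf{x},\omega t)$ with state $\mathbf{x}=[x_1^T\ x_2^T\ \ldots\ x_p^T]^T\in\mathbb{R}^{2p}$, $x_i\in\mathbb{R}^2$, given componentwise by $$\dot{x}_i=\begin{bmatrix}-\sin\omega t\\ \cos\omega t\end{bmatrix}\sum_{j\neq i}\gamma_{ij}\big([-\sin\omega t\ \ \cos\omega t](x_j-x_i)\big),\qquad i=1,2,\dots,p.$$ Then the synchronization manifold $\mathcal{A}=\{\mathbf{x}\in\mathbb{R}^{2p}: x_i=x_j\ \text{for all } i,j\}$ is semiglobally practically asymptotically stable for this system.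
   Context: $|\cdot|$ is the Euclidean norm. For a closed set $\mathcal{S}\subset\mathbb{R}^n$ and $x\in\mathbb{R}^n$, $|x|_{\mathcal{S}}$ is the Euclidean distance from $x$ to $\mathcal{S}$. A function $\alpha:\mathbb{R}_{\ge0}\to\mathbb{R}_{\ge0}$ is of class $\mathcal{K}$ if it is continuous, zero at zero, and strictly increasing. Interconnection: a set of functions $\{\gamma_{ij}:\mathbb{R}\to\mathbb{R}\}$, $i,j=1,\dots,p$, $i\neq j$, is an interconnection if for all $i,j$ and all $s\in\mathbb{R}$: (i) $\gamma_{ij}(0)=0$ and $s\gamma_{ij}(s)\ge0$; (ii) either $\gamma_{ij}\equiv0$ (written $\gamma_{ij}=0$), or (written $\gamma_{ij}\neq 0$) there exists $\alpha$ of class $\mathcal{K}$ such that $|\gamma_{ij}(s)|\ge\alpha(|s|)$ for all $s$. Graph of an interconnection: the directed graph with nodes $n_1,\dots,n_p$ in which $(n_i,n_j)$ is an edge iff $\gamma_{ij}\neq0$. A directed path from $n_1$ to $n_\ell$ is a sequence of nodes $(n_1,\dots,n_\ell)$ with each $(n_k,n_{k+1})$ an edge. A directed graph is connected if it has a node to which there exists a directed path from every other node. An interconnection is connected if its graph is connected. Semiglobal practical asymptotic stability: for a system $\dot{\mathbf{x}}=f(\mathbf{x},\omega t)$, a closed set $\mathcal{S}$ is semiglobally practically asymptotically stable if for each pair $(\Delta,\delta)$ of positive numbers there exists $\omega^*>0$ such that for each $\omega\ge\omega^*$ the following hold for solutions $\mathbf{x}(\cdot)$ of the system. (a) For each $r>\delta$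 there exists $\varepsilon>0$ such that $|\mathbf{x}(0)|_{\mathcal{S}}\le\varepsilon\implies|\mathbf{x}(t)|_{\mathcal{S}}\le r$ for all $t\ge0$. (b) For each $\varepsilon<\Delta$ there exists $r>0$ such that $|\mathbf{x}(0)|_{\mathcal{S}}\le\varepsilon\implies|\mathbf{x}(t)|_{\mathcal{S}}\le r$ for all $t\ge0$. (c) For each $r<\Delta$ and $\varepsilon>\delta$ there exists $T>0$ such that $|\mathbf{x}(0)|_{\mathcal{S}}\le r\implies|\mathbf{x}(t)|_{\mathcal{S}}\le\varepsilon$ for all $t\ge T$. *)

(* Defs.v *)
From HB Require Import structures.
From mathcomp Require Import all_boot all_order all_algebra.
From mathcomp Require Import all_classical all_reals all_analysis.

Set Implicit Arguments.
Unset Strict Implicit.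
Unset Printing Implicit Defensive.

Import Order.TTheory GRing.Theory Num.Theory.
Import numFieldNormedType.Exports.

Local Open Scope classical_set_scope.
Local Open Scope ring_scope.

(* A vector of R^(m * n) is represented as an m x n matrix;
   a state [x_1; ...; x_p] with x_i in R^2 is the p x 2 matrix whose i-th row
   is (the transpose of) x_i. *)

(* The library norm `|x| on matrices is the max norm, hence these definitions;
   both norms induce the same topology and the same derivatives. *)
Definition euclid_norm (R : realType) (m n : nat) (x : 'M[R]_(m, n)) : R :=
  Num.sqrt (\sum_i \sum_j x i j ^+ 2).

Definition euclid_dist (R : realType) (m n : nat) (S : set 'M[R]_(m, n))
    (x : 'M[R]_(m, n)) : R :=
  inf [set euclid_norm (x - y) | y in S].

(* Only the restriction of alpha to [0, +oo[ matters; it takes nonnegative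
   values there because it vanishes at 0 and increases. *)
Definition class_K (R : realType) (alpha : R -> R) : Prop :=
  [/\ {within [set s : R | 0 <= s], continuous alpha},
      alpha 0 = 0 &
      forall s t : R, 0 <= s -> s < t -> alpha s < alpha t].

Definition locally_lipschitz (R : realType) (g : R -> R) : Prop :=
  forall s : R, exists2 U : set R, nbhs s U &
    [lipschitz g u | u in U].

(* The meaning given to "gamma_ij <> 0" in an interconnection. *)
Definition nonzero_gain (R : realType) (g : R -> R) : Prop :=
  exists2 alpha : R -> R, class_K alpha & forall s : R, alpha `|s| <= `|g s|.

(* The diagonal functions gamma i i are irrelevant. *)
Definition interconnection (R : realType) (p : nat)
    (gamma : 'I_p -> 'I_p -> R -> R) : Prop :=
  forall i j : 'I_p, i != j ->
    [/\ gamma i j 0 = 0,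
        forall s : R, 0 <= s * gamma i j s &
        (forall s : R, gamma i j s = 0) \/ nonzero_gain (gamma i j)].

Definition interconnection_edge (R : realType) (p : nat)
    (gamma : 'I_p -> 'I_p -> R -> R) : rel 'I_p :=
  [rel i j | (i != j) && `[< nonzero_gain (gamma i j) >]].

Definition graph_connected (p : nat) (e : rel 'I_p) : Prop :=
  exists i : 'I_p, forall j : 'I_p, j != i -> connect e j i.

Definition connected_interconnection (R : realType) (p : nat)
    (gamma : 'I_p -> 'I_p -> R -> R) : Prop :=
  interconnection gamma /\ graph_connected (interconnection_edge gamma).

(* x solves x' = f (x, omega t) on [0, b[, where b may be +oo; the values of x
   outside [0, b[ are irrelevant. For continuous f the right derivative at 0 is
   then f (x 0, 0) as well. *)
Definition solution_on (R : realType) (m n : nat)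
    (f : 'M[R]_(m, n) -> R -> 'M[R]_(m, n)) (omega : R) (b : \bar R)
    (x : R -> 'M[R]_(m, n)) : Prop :=
  [/\ (0 < b)%E,
      {within [set t : R | 0 <= t /\ (t%:E < b)%E], continuous x} &
      forall t : R, 0 < t -> (t%:E < b)%E ->
        is_derive t 1 x (f (x t) (omega * t))].

Definition maximal_solution (R : realType) (m n : nat)
    (f : 'M[R]_(m, n) -> R -> 'M[R]_(m, n)) (omega : R) (b : \bar R)
    (x : R -> 'M[R]_(m, n)) : Prop :=
  solution_on f omega b x /\
  forall (b' : \bar R) (y : R -> 'M[R]_(m, n)),
    solution_on f omega b' y -> (b <= b')%E ->
    (forall t : R, 0 <= t -> (t%:E < b)%E -> y t = x t) -> b' = b.

(* A bound "for all t >= t0" on a solution includes the absence of finite escape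
   time: the maximal interval of existence is [0, +oo[. *)
Definition bounded_from (R : realType) (m n : nat) (S : set 'M[R]_(m, n))
    (b : \bar R) (x : R -> 'M[R]_(m, n)) (t0 r : R) : Prop :=
  b = +oo%E /\ forall t : R, t0 <= t -> euclid_dist S (x t) <= r.

Definition semiglobally_practically_asymptotically_stable (R : realType)
    (m n : nat) (f : 'M[R]_(m, n) -> R -> 'M[R]_(m, n))
    (S : set 'M[R]_(m, n)) : Prop :=
  closed S /\
  forall Delta delta : R, 0 < Delta -> 0 < delta ->
  exists2 omega0 : R, 0 < omega0 &
  forall omega : R, omega0 <= omega ->
  [/\ forall r : R, delta < r -> exists2 eps : R, 0 < eps &
        forall (b : \bar R) (x : R -> 'M[R]_(m, n)),
          maximal_solution f omega b x ->
          euclid_dist S (x 0) <= eps -> bounded_from S b x 0 r,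
      forall eps : R, eps < Delta -> exists2 r : R, 0 < r &
        forall (b : \bar R) (x : R -> 'M[R]_(m, n)),
          maximal_solution f omega b x ->
          euclid_dist S (x 0) <= eps -> bounded_from S b x 0 r &
      forall r eps : R, r < Delta -> delta < eps -> exists2 T : R, 0 < T &
        forall (b : \bar R) (x : R -> 'M[R]_(m, n)),
          maximal_solution f omega b x ->
          euclid_dist S (x 0) <= r -> bounded_from S b x T eps].

Definition rotating_direction (R : realType) (tau : R) : 'rV[R]_2 :=
  \row_(k < 2) (if k == 0 then - sin tau else cos tau).

Definition oscillator_field (R : realType) (p : nat)
    (gamma : 'I_p -> 'I_p -> R -> R) (x : 'M[R]_(p, 2)) (tau : R) :
    'M[R]_(p, 2) :=
  \matrix_(i < p)
    ((\sum_(j < p | j != i)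
        gamma i j ((rotating_direction tau *m (row j x - row i x)^T) 0 0))
       *: rotating_direction tau).

Definition synchronization_manifold (R : realType) (p : nat) :
    set 'M[R]_(p, 2) :=
  [set x | forall i j : 'I_p, row i x = row j x].

(* Main.v *)
Require Import Defs.
From mathcomp Require Import all_boot all_order all_algebra.
From mathcomp Require Import all_classical all_reals all_analysis.
From mathcomp Require Import ring lra.

(** The right-hand side depends only on differences of states, and is fast
    periodic in time. The proof compares a solution, sampled at the multiples of
    the period [h = 2 pi / omega], with a discrete consensus process, and is
    quantitative throughout.

    Averaging. Let [d(tau) = (- sin tau, cos tau)]. The mean of
    [d(tau) g (d(tau) . y)] over a period is a multiple [w y] of y with
    [0 <= w <= L] when g is L-Lipschitz: the component orthogonal to y is the
    derivative of a periodic function ([averaged_coupling]). Hence, up to an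
    error of order [h * h], one period maps each coordinate z of the state to
    [z_i + h * sum_j w_ij (z_j - z_i)] with nonnegative weights that are the
    same for both coordinates ([period_step]). As a nonzero gain may be
    arbitrarily flat at 0, the weight of an edge is bounded below only when the
    two nodes are at distance at least c, by a constant that depends on c.

    Contraction. Some node r is heard, directly or not, by all the others. Over
    a suitable fixed time T0, r keeps a part of its distance to the farther end
    of the range of the values z_i, and pulls all the other nodes away from this
    end, level by level along the paths to r ([level_bound]). So as long as the
    spread is at least c0, it decreases by a fixed amount, in T0 / h steps,
    minus errors which are of order h in total ([spread_contraction]). For large
    omega the spread therefore falls to the level c0 and, within and after
    these steps, exceeds its guaranteed value by 2 c0 at most
    ([bounded_system_contracts]).

    Global existence. To have constants that are valid for all states, the
    gains are first clamped to be bounded and globally Lipschitz; then solutions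
    exist for all times ([picard_global]). The bound on the spread shows
    afterwards that clamping has no effect along the solutions considered, and
    uniqueness ([solution_unique]) identifies these with the maximal solutions
    of the original system ([maximal_solution_contracts]). Since the spread and
    the distance to the synchronization manifold are equivalent, the three
    properties to be proved follow. *)

Set Implicit Arguments.
Unset Strict Implicit.
Unset Printing Implicit Defensive.

Import Order.TTheory GRing.Theory Num.Theory.
Import numFieldNormedType.Exports.

Local Open Scope classical_set_scope.
Local Open Scope ring_scope.

(** * Derivatives, increments and primitives *)

Section PointwiseDerivatives.
Context {R : realType}.
Implicit Types (f g : R -> R) (s c : R).

Lemma is_derive_add f g s (df dg : R) : is_derive s 1 f df -> is_derive s 1 g dg ->
  is_derive s 1 (fun s => f s + g s) (df + dg).
Proof. by move=> fD gD; exact: (is_deriveD fD gD). Qed.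

Lemma is_derive_scale f c s (df : R) : is_derive s 1 f df ->
  is_derive s 1 (fun s => c * f s) (c * df).
Proof. by move=> fD; exact: (is_deriveZ c fD). Qed.

Lemma is_derive_mul f g s (df dg : R) : is_derive s 1 f df -> is_derive s 1 g dg ->
  is_derive s 1 (fun s => f s * g s) (f s * dg + g s * df).
Proof. by move=> fD gD; exact: (is_deriveM fD gD). Qed.

Lemma is_derive_comp f g s (df dg : R) : is_derive s 1 f df ->
  is_derive (f s) 1 g dg -> is_derive s 1 (fun s => g (f s)) (dg * df).
Proof. by move=> fD gD; exact: (is_derive1_comp gD fD). Qed.

Lemma is_derive_lin c s : is_derive s 1 (fun s => c * s) c.
Proof.
by have := is_derive_scale c (is_derive_id s (1 : R)); rewrite mulr1.
Qed.

Lemma is_derive_big (I : Type) (r : seq I) (P : pred I) (f : I -> R -> R)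
    (df : I -> R) s : (forall i, P i -> is_derive s 1 (f i) (df i)) ->
  is_derive s 1 (fun s => \sum_(i <- r | P i) f i s) (\sum_(i <- r | P i) df i).
Proof.
move=> fD; elim: r => [|i r IH].
  rewrite big_nil; under eq_fun do rewrite big_nil.
  exact: is_derive_cst.
rewrite big_cons; under eq_fun do rewrite big_cons.
by case: ifPn => // Pi; exact: is_derive_add (fD i Pi) IH.
Qed.

End PointwiseDerivatives.

Section Calculus.
Context {R : realType}.
Implicit Types (f g df dg : R -> R) (a b s t : R).

Lemma is_derive_continuous f (d t : R) :
  is_derive t 1 f d -> {for t, continuous f}.
Proof.
by move=> H; apply/differentiable_continuous/derivable1_diffP; case: H.
Qed.

(** Differentiability is required in the open interval only, because solutions
    of the differential equation need not be differentiable at time 0. *)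
Lemma increment_ge0_within f df a b : a <= b ->
  {within `[a, b], continuous f} ->
  (forall t, a < t < b -> is_derive t 1 f (df t)) ->
  (forall t, a < t < b -> 0 <= df t) -> f a <= f b.
Proof.
rewrite le_eqVlt => /predU1P[-> //|ab] fC fD df0.
have fD' t : t \in `]a, b[%R -> is_derive t 1 f (df t).
  by rewrite in_itv; exact: fD.
have [c cab E] := MVT ab fD' fC.
by rewrite -subr_ge0 E mulr_ge0 ?subr_ge0 ?(ltW ab) ?df0.
Qed.

Lemma increment_le f g df dg a b : a <= b ->
  (forall t, a <= t <= b -> is_derive t 1 f (df t)) ->
  (forall t, a <= t <= b -> is_derive t 1 g (dg t)) ->
  (forall t, a <= t <= b -> df t <= dg t) ->
  f b - f a <= g b - g a.
Proof.
move=> ab fD gD le_dfg.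
have hD t : a <= t <= b -> is_derive t 1 (g - f) (dg t - df t).
  by move=> tab; have := fD t tab; have := gD t tab => ? ?; exact: is_deriveB.
have : (g - f) a <= (g - f) b.
  apply: (@increment_ge0_within _ (dg - df) _ _ ab).
  - apply: derivable_within_continuous => t; rewrite in_itv/= => tab.
    by case: (hD t tab).
  - by move=> t /andP[at_ tb]; apply: hD; rewrite !ltW.
  - by move=> t /andP[at_ tb]; rewrite !fctE subr_ge0 le_dfg // !ltW.
rewrite !fctE; lra.
Qed.

Lemma increment_normr_le f g df dg a b : a <= b ->
  (forall t, a <= t <= b -> is_derive t 1 f (df t)) ->
  (forall t, a <= t <= b -> is_derive t 1 g (dg t)) ->
  (forall t, a <= t <= b -> `|df t| <= dg t) ->
  `|f b - f a| <= g b - g a.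
Proof.
move=> ab fD gD le_dfg; rewrite ler_norml; apply/andP; split; last first.
  apply: (increment_le ab fD gD) => t tab.
  by rewrite (le_trans _ (le_dfg t tab)) ?ler_norm.
have NfD t : a <= t <= b -> is_derive t 1 (- f) (- df t).
  by move=> tab; have := fD t tab => ?; exact: is_deriveN.
have := increment_le ab NfD gD.
rewrite !fctE => H.
suff : - f b - - f a <= g b - g a by lra.
apply: H => t tab.
by rewrite (le_trans _ (le_dfg t tab)) // -normrN ler_norm.
Qed.

Lemma increment_normr_le_cst f df a b M : a <= b ->
  (forall t, a <= t <= b -> is_derive t 1 f (df t)) ->
  (forall t, a <= t <= b -> `|df t| <= M) ->
  `|f b - f a| <= M * (b - a).
Proof.
move=> ab fD le_dfM; rewrite mulrBr.
apply: (@increment_normr_le f (fun t => M * t) df (fun=> M)) => // t _.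
exact: is_derive_lin.
Qed.

Lemma derive0_cst f a b : a <= b ->
  (forall t, a <= t <= b -> is_derive t 1 f 0) -> f b = f a.
Proof.
move=> ab fD; apply/eqP; rewrite -subr_eq0 -normr_le0 -(mul0r (b - a)).
by apply: (increment_normr_le_cst ab fD) => t _; rewrite normr0.
Qed.

(** The integral from a fixed base point a provides a primitive on one side of a
    only. *)
Lemma continuous_primitive f a : continuous f ->
  exists G : R -> R, forall t, a < t -> is_derive t 1 G (f t).
Proof.
move=> fC.
exists (fun x => (\int[lebesgue_measure]_(t in `[a, x]) f t)) => t at_.
have [||||D1 D2] := @continuous_FTC1_closed R f a t (t + 1).
- by rewrite ltrDl.
- apply: continuous_compact_integrable; first exact: segment_compact.
  exact: continuous_subspaceT.
- by [].
- exact: fC.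
by apply: (DeriveDef D1); rewrite -D2; exact/esym/derive1E.
Qed.

End Calculus.

(** * Global existence and uniqueness for differential equations *)

Section Picard.
Context {R : realType}.

Lemma le_of_geometric (x y C : R) :
  (forall n, x <= y + C / 2 ^+ n) -> x <= y.
Proof.
move=> H; apply/ler_addgt0Pr => e e0.
pose n := Num.truncn (`|C| / e).
apply: (le_trans (H n)); rewrite lerD2l ler_pdivrMr ?exprn_gt0 //.
rewrite (le_trans (ler_norm C)) // -ler_pdivrMl // mulrC.
have q0 : 0 <= `|C| / e by rewrite divr_ge0 // ltW.
have /andP[_ /ltW/le_trans->//] := truncn_itv q0.
by rewrite -natrX ler_nat ltn_expl.
Qed.

Lemma double_halfX (c : R) n : 2 * c / 2 ^+ n.+1 = c / 2 ^+ n.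
Proof. by rewrite exprS invfM; move: (2 ^+ n)^-1 => q; lra. Qed.

(** The limit is the supremum of the increasing sequence of lower estimates
    [u n - 2 C / 2 ^ n], which lies below every upper estimate. *)
Lemma geometric_cauchy (u : nat -> R) C :
  (forall n, `|u n.+1 - u n| <= C / 2 ^+ n) ->
  exists l, forall n, `|u n - l| <= 2 * C / 2 ^+ n.
Proof.
move=> H.
have E n : C / 2 ^+ n = 2 * C / 2 ^+ n - 2 * C / 2 ^+ n.+1.
  by rewrite exprS invfM; move: (2 ^+ n)^-1 => q; lra.
pose a n := u n + 2 * C / 2 ^+ n; pose b n := u n - 2 * C / 2 ^+ n.
have C0 n : 0 <= 2 * C / 2 ^+ n.
  rewrite -mulrA mulr_ge0 //.
  have := H 0%N; rewrite expr0 divr1 => /(le_trans (normr_ge0 _)) C0.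
  by rewrite divr_ge0 // exprn_ge0.
have aD : nonincreasing_seq a.
  by apply/nonincreasing_seqP => k; have := H k; rewrite E ler_norml /a; lra.
have bI : nondecreasing_seq b.
  by apply/nondecreasing_seqP => k; have := H k; rewrite E ler_norml /b; lra.
have ba k m : b k <= a m.
  apply: (@le_trans _ _ (b (maxn k m))); first by apply: bI; rewrite leq_maxl.
  apply: (@le_trans _ _ (a (maxn k m))); last by apply: aD; rewrite leq_maxr.
  by have := C0 (maxn k m); rewrite /a /b; lra.
exists (sup (range b)) => n.
have bub : has_ubound (range b) by exists (a 0%N) => _ [m _ <-].
have : b n <= sup (range b) by apply: ub_le_sup => //; exists n.
have : sup (range b) <= a n.
  by apply: ge_sup; [exists (b 0%N), 0%N | move=> _ [m _ <-]].
rewrite ler_norml /a /b; lra.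
Qed.

Lemma lipschitz_continuous (f : R -> R) (k : R) :
  (forall s t, `|f t - f s| <= k * `|t - s|) -> continuous f.
Proof.
move=> fk t; apply/cvgrPdist_le => e e0.
near=> s; apply: le_trans (fk s t) _.
apply: (@le_trans _ _ ((`|k| + 1) * `|t - s|)).
  by rewrite ler_wpM2r // (le_trans (ler_norm k)) // lerDl.
have k1 : 0 < `|k| + 1 by rewrite ltr_wpDl.
rewrite mulrC -ler_pdivlMr //; near: s.
by apply: cvgr_dist_le; [exact: cvg_id|exact: divr_gt0].
Unshelve. all: by end_near. Qed.

(** Picard iteration. In the norm [sup_t |u t| exp(- 2 L t)] the integral
    operator contracts by one half on the whole half-line, so that no patching
    of local solutions is needed. The index type may be infinite: every bound
    is uniform in the index. *)
Lemma picard_global (I : Type) (F : R -> (I -> R) -> I -> R) (L B : R)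
    (x0 : I -> R) :
  0 < L -> 0 <= B ->
  (forall t x i, `|F t x i| <= B) ->
  (forall t x y (e : R), (forall i, `|x i - y i| <= e) ->
     forall i, `|F t x i - F t y i| <= L * e) ->
  (forall u : R -> I -> R, (forall i, continuous (u^~ i)) ->
     forall i, continuous (fun t : R => F t (u t) i)) ->
  exists u : R -> I -> R, (forall i, u 0 i = x0 i) /\
    forall (t : R) i, 0 <= t -> is_derive t 1 (u^~ i) (F t (u t) i).
Proof.
move=> L0 B0 FB FL FC.
(* Iterates are frozen for negative times, where no estimate is available;
   the companion [w.2] is the unfrozen primitive, differentiable at 0. *)
pose path := {u : R -> I -> R | forall i, continuous (u^~ i)}.
have step (u : path) : exists w : path * (R -> I -> R), forall i,
    [/\ w.2 0 i = x0 i,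
        forall t : R, 0 <= t -> is_derive t 1 (w.2^~ i) (F t (sval u t) i) &
        forall t : R, sval w.1 t i = w.2 (Num.max t 0) i].
  have primE i : exists G : R -> R, G 0 = x0 i /\
      forall t : R, 0 <= t -> is_derive t 1 G (F t (sval u t) i).
    have [G GD] := continuous_primitive (-1) (FC _ (svalP u) i).
    exists (fun t => G t + (x0 i - G 0)); split; first by rewrite addrC subrK.
    move=> t t0; have tD : is_derive t 1 G (F t (sval u t) i).
      by apply: GD; rewrite (lt_le_trans _ t0) // ltrN10.
    by have := is_deriveD tD (is_derive_cst (x0 i - G 0) t 1); rewrite addr0.
  have [G GP] := choice primE.
  have vC (i : I) : continuous (fun t : R => G i (Num.max t 0)).
    move=> t; apply: (@continuous_comp _ _ _ (fun t : R => Num.max t 0) (G i)).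
      by apply: continuous_max; [exact: cvg_id|exact: cvg_cst].
    have [_ GD] := GP i.
    by apply: is_derive_continuous (GD _ _); rewrite le_max lexx orbT.
  exists (exist _ (fun (t : R) i => G i (Num.max t 0)) vC, fun t i => G i t) => i /=.
  by have [G0 GD] := GP i; split.
have [T TP] := choice step.
have x0C i : continuous ((fun _ : R => x0)^~ i) by exact: cst_continuous.
pose U n : path := iter n (fun u => (T u).1) (exist _ (fun _ => x0) x0C).
pose V n : R -> I -> R := (T (U n)).2.
have V0 n i : V n 0 i = x0 i by have [] := TP (U n) i.
have VD n (t : R) i : 0 <= t -> is_derive t 1 (V n ^~ i) (F t (sval (U n) t) i).
  by have [_ + _] := TP (U n) i; exact.
have UE n (t : R) i : sval (U n.+1) t i = V n (Num.max t 0) i.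
  by have [_ _] := TP (U n) i; exact.
have UV n (t : R) i : 0 <= t -> sval (U n.+1) t i = V n t i.
  by move=> t0; rewrite UE max_l.
pose C0 := B / (2 * L).
pose W t : R := expR (2 * L * t).
have WD c (t : R) : is_derive t 1 (fun t => c * W t) (c * (2 * L * W t)).
  have D1 : is_derive t 1 (fun t => 2 * L * t) (2 * L).
    exact: is_derive_lin.
  have := is_deriveZ c (is_derive1_comp (is_derive_expR (2 * L * t)) D1).
  by rewrite /GRing.scale/= [_ * (2 * L)]mulrC.
have W0 t : 0 < W t by exact: expR_gt0.
have C00 : 0 <= C0 by rewrite divr_ge0 // mulr_ge0 // ltW.
have VL n (s t : R) i : 0 <= s -> s <= t -> `|V n t i - V n s i| <= B * (t - s).
  move=> s0 st.
  apply: (@increment_normr_le_cst _ (V n ^~ i) (fun t => F t (sval (U n) t) i)).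
  - exact: st.
  - by move=> r /andP[sr _]; apply: VD; rewrite (le_trans s0).
  - by move=> r _; exact: FB.
have contract n (v y : R -> I -> R) c :
    (forall i, v 0 i = x0 i) ->
    (forall (t : R) i, 0 <= t -> is_derive t 1 (v^~ i) (F t (y t) i)) ->
    (forall (t : R) i, 0 <= t -> `|y t i - sval (U n) t i| <= c * W t) ->
    forall (t : R) i, 0 <= t -> `|v t i - V n t i| <= c / 2 * W t.
  move=> v0 vD yU t i t0.
  have c0 : 0 <= c.
    by rewrite -(pmulr_lge0 _ (W0 0)) (le_trans _ (yU 0 i (lexx 0))).
  have D (s : R) : 0 <= s <= t ->
      is_derive s 1 (v^~ i - V n ^~ i) (F s (y s) i - F s (sval (U n) s) i).
    by move=> /andP[s0 _]; apply: is_deriveB; [exact: vD|exact: VD].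
  have := increment_normr_le t0 D (fun s _ => WD (c / 2) s).
  rewrite !fctE v0 V0 subrr subr0 => /(_ _)/le_trans; apply.
    move=> s /andP[s0 _]; apply: le_trans (FL _ _ _ (c * W s) _ _) _.
      by move=> k; exact: yU.
    by rewrite le_eqVlt; apply/orP; left; apply/eqP; field.
  by rewrite lerBlDr lerDl mulr_ge0 ?divr_ge0 // ltW.
have UU n (t : R) i : 0 <= t ->
    `|sval (U n.+1) t i - sval (U n) t i| <= C0 * W t / 2 ^+ n.
  elim: n t i => [|n IH] t i t0.
    rewrite UV // -[sval (U 0%N) t i]/(x0 i) -(V0 0%N i) expr0 divr1.
    apply: le_trans (VL _ _ _ _ (lexx 0) t0) _; rewrite subr0.
    apply: (@le_trans _ _ (C0 * (2 * L * t))).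
      by rewrite /C0 le_eqVlt; apply/orP; left; apply/eqP; field; rewrite gt_eqF.
    rewrite ler_wpM2l ?C00 //; by apply: le_trans (expR_ge1Dx _); rewrite lerDr.
  rewrite (UV n.+1) // (UV n) // mulrAC.
  have -> : C0 / 2 ^+ n.+1 = (C0 / 2 ^+ n) / 2.
    by rewrite exprSr invfM mulrA.
  apply: (contract _ _ (sval (U n.+1))) => //.
  by move=> s j s0; rewrite mulrAC; exact: IH.
have [l lP] : exists l : R -> I -> R, forall (t : R) i n, 0 <= t ->
    `|sval (U n) t i - l t i| <= 2 * (C0 * W t) / 2 ^+ n.
  have lE (q : R * I) : exists l, 0 <= q.1 -> forall n,
      `|sval (U n) q.1 q.2 - l| <= 2 * (C0 * W q.1) / 2 ^+ n.
    case: q => t i /=; case: (leP 0 t) => t0; last by exists 0.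
    by have [l lP] := geometric_cauchy (fun n => UU n t i t0); exists l.
  have [l lP] := choice lE; exists (fun t i => l (t, i)) => t i n t0.
  exact: lP (t, i) t0 n.
pose u (t : R) := l (Num.max t 0).
have uL (s t : R) i : `|u t i - u s i| <= B * `|t - s|.
  wlog st : s t / s <= t => [H|].
    case: (leP s t) => [|/ltW] st; first exact: H.
    by rewrite distrC (distrC t); exact: H.
  have M0 r : 0 <= Num.max r 0 :> R by rewrite le_max lexx orbT.
  have Mst : Num.max s 0 <= Num.max t 0 by rewrite le_max2.
  apply: (@le_of_geometric _ _ (C0 * W (Num.max s 0) + C0 * W (Num.max t 0))).
  move=> n.
  have := lP _ i n.+1 (M0 s); have := lP _ i n.+1 (M0 t).
  rewrite !UV //; have := VL n _ _ i (M0 s) Mst; rewrite -/(u t) -/(u s).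
  have : B * (Num.max t 0 - Num.max s 0) <= B * `|t - s|.    apply: ler_wpM2l => //.
    rewrite ger0_norm ?subr_ge0 //.
    by case: (leP s 0) => s0; case: (leP t 0) => t0; lra.
  rewrite !double_halfX mulrDl.
  move: (C0 * W (Num.max s 0) / _) (C0 * W (Num.max t 0) / _).
  move=> c1 c2; rewrite !ler_norml; lra.
(* The bound B makes all iterates, hence the limit, B-Lipschitz. *)
have uC i : continuous (u^~ i).
  by apply: (@lipschitz_continuous _ B) => s t; exact: uL.
(* One more integration of the limit gives a differentiable function, which
   is the limit itself. *)
pose v := (T (exist _ u uC)).2.
have v0 i : v 0 i = x0 i by have [] := TP (exist _ u uC) i.
have vD (t : R) i : 0 <= t -> is_derive t 1 (v ^~ i) (F t (u t) i).
  by have [_ + _] := TP (exist _ u uC) i; exact.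
have vu (t : R) : 0 <= t -> v t = u t.
  move=> t0; apply/funext => i; apply/eqP; rewrite -subr_eq0 -normr_le0.
  apply: (@le_of_geometric _ _ (2 * (C0 * W t))) => n; rewrite add0r.
  have uU (s : R) j : 0 <= s -> `|u s j - sval (U n) s j| <= 2 * C0 / 2 ^+ n * W s.
    by move=> s0; rewrite distrC /u max_l // mulrAC -[2 * C0 * W s]mulrA; exact: lP.
  have := contract n v u _ v0 vD uU t i t0.
  have := lP t i n.+1 t0; rewrite -(UV n) // /u max_l //.
  have -> : 2 * C0 / 2 ^+ n / 2 * W t = C0 * W t / 2 ^+ n.
    by rewrite (mulrAC _ _ (2^-1)) -(mulrAC C0) [2 * C0]mulrC mulfK.
  rewrite double_halfX => H1 H2.
  have -> : v t i - l t i =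
      (v t i - sval (U n.+1) t i) + (sval (U n.+1) t i - l t i).
    by rewrite addrA subrK.
  apply: le_trans (ler_normD _ _) _; lra.
exists v; split => // t i t0; rewrite vu //; exact: vD.
Qed.

End Picard.

Section Uniqueness.
Context {R : realType} {I : finType}.

(** The squared distance q satisfies [q' <= k q], so [q exp(- k t)] does not
    increase, and it starts from 0. The estimate of the right-hand sides is
    required along the two given solutions only, which suits equations that
    are merely locally Lipschitz. *)
Lemma ode_unique (x y fx fy : R -> I -> R) (C b : R) : 0 <= C -> 0 <= b ->
  (forall i, {within `[0, b], continuous (x^~ i)}) ->
  (forall i, {within `[0, b], continuous (y^~ i)}) ->
  (forall i (t : R), 0 < t < b -> is_derive t 1 (x^~ i) (fx t i)) ->
  (forall i (t : R), 0 < t < b -> is_derive t 1 (y^~ i) (fy t i)) ->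
  (forall i t, 0 < t < b ->
     `|fx t i - fy t i| <= C * \sum_j `|x t j - y t j|) ->
  (forall i, x 0 i = y 0 i) -> forall i, x b i = y b i.
Proof.
move=> C0 b0 xC yC xD yD fxy xy0.
pose d i t : R := x t i - y t i.
pose q t : R := \sum_i d i t ^+ 2.
pose k := 2 * C * #|I|%:R.
have dD i (t : R) : 0 < t < b -> is_derive t 1 (d i) (fx t i - fy t i).
  by move=> tb; apply: is_deriveB; [exact: xD|exact: yD].
have qD (t : R) : 0 < t < b ->
    is_derive t 1 q (\sum_i 2 * (d i t * (fx t i - fy t i))).
  move=> tb; apply: is_derive_big => i _.
  have := is_derive_mul (dD i t tb) (dD i t tb).
  by congr is_derive; ring.
have q_ge0 t : 0 <= q t by apply: sumr_ge0 => i _; exact: sqr_ge0.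
have q'le t : 0 < t < b -> \sum_i 2 * (d i t * (fx t i - fy t i)) <= k * q t.
  move=> tb.
  have bnd i : 2 * (d i t * (fx t i - fy t i)) <=
      \sum_j C * (d i t ^+ 2 + d j t ^+ 2).
    apply: (@le_trans _ _ (2 * (`|d i t| * (C * \sum_j `|d j t|)))).
      rewrite ler_wpM2l //; apply: le_trans (ler_norm _) _.
      by rewrite normrM ler_wpM2l //; exact: fxy.
    have -> (u s : R) : 2 * (u * (C * s)) = C * (2 * u * s) by ring.
    rewrite -mulr_sumr ler_wpM2l // mulr_sumr.
    apply: ler_sum => j _; rewrite -(real_normK (num_real (d i t))).
    rewrite -(real_normK (num_real (d j t))).
    by have := sqr_ge0 (`|d i t| - `|d j t|); lra.
  apply: le_trans (ler_sum _ (fun i _ => bnd i)) _.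
  rewrite le_eqVlt; apply/orP; left; apply/eqP.
  under eq_bigr do rewrite -mulr_sumr big_split /= sumr_const.
  rewrite -mulr_sumr big_split /= sumr_const -/(q t) sumrMnl -/(q t).
  by rewrite -[q t *+ _]mulr_natl /k; ring.
pose E t := - (q t * expR (- k * t)).
have ED (t : R) : 0 < t < b -> is_derive t 1 E
    (- (q t * (expR (- k * t) * - k) +
        expR (- k * t) * \sum_i 2 * (d i t * (fx t i - fy t i)))).
  move=> tb; apply: is_deriveN; apply: (is_derive_mul (qD t tb)).
  exact: is_derive_comp (is_derive_lin (- k) t) (is_derive_expR _).
have dC i : {within `[0, b], continuous (d i)}.
  by move=> t; apply: cvgB; [exact: xC|exact: yC].
have EC : {within `[0, b], continuous E}.
  move=> t; apply: cvgN; apply: cvgM.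
    apply: cvg_big => [|i _]; first exact: add_continuous.
    exact: (cvgM (dC i t) (dC i t)).
  apply: continuous_subspaceT => s.
  exact: is_derive_continuous
    (is_derive_comp (is_derive_lin (- k) s) (is_derive_expR _)).
have : E 0 <= E b.
  apply: (increment_ge0_within b0 EC ED) => t tb.
  have := ler_wpM2l (ltW (expR_gt0 (- k * t))) (q'le t tb); lra.
have -> : E 0 = 0.
  rewrite /E /q big1 ?mul0r ?oppr0 // => i _.
  by rewrite /d xy0 subrr expr0n.
rewrite oppr_ge0 pmulr_lle0 ?expR_gt0 // => qb i.
have : \sum_i d i b ^+ 2 == 0 by rewrite eq_le qb q_ge0.
rewrite psumr_eq0 => [/allP/(_ i)|j _]; last exact: sqr_ge0.
by rewrite mem_index_enum sqrf_eq0 subr_eq0 => /(_ isT)/eqP.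
Qed.

End Uniqueness.

(** * Averaging over one period of the rotating direction *)

Section Averaging.
Context {R : realType}.
Implicit Types (s tau omega : R) (y : 'I_2 -> R).

Definition dir tau (k : 'I_2) : R := if k == 0 then - sin tau else cos tau.

(** The component of y along the rotating direction [dir tau]. *)
Definition rproj tau y : R := - sin tau * y 0 + cos tau * y 1.

Definition sqnorm y : R := y 0 ^+ 2 + y 1 ^+ 2.

Lemma sqr_rproj_le tau y : rproj tau y ^+ 2 <= sqnorm y.
Proof.
rewrite -subr_ge0 [X in 0 <= X](_ : _ = (cos tau * y 0 + sin tau * y 1) ^+ 2).
  by rewrite sqr_ge0.
by rewrite /rproj /sqnorm; have H := cos2sin2 tau; ring: H.
Qed.

Lemma normr_dir_le1 tau k : `|dir tau k| <= 1.
Proof.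
rewrite /dir; case: ifP => _; rewrite ?normrN ler_norml.
  by rewrite sin_geN1 sin_le1.
by rewrite cos_geN1 cos_le1.
Qed.

Lemma sin_period (x : R) : sin (x + (pi + pi)) = sin x.
Proof. by rewrite addrA !sinDpi opprK. Qed.

Lemma cos_period (x : R) : cos (x + (pi + pi)) = cos x.
Proof. by rewrite addrA !cosDpi opprK. Qed.

Lemma phase_period omega s : omega != 0 ->
  omega * (s + 2 * pi / omega) = omega * s + (pi + pi).
Proof. by move=> omega0; field. Qed.

Lemma rproj_period omega s y : omega != 0 ->
  rproj (omega * (s + 2 * pi / omega)) y = rproj (omega * s) y.
Proof. by move=> ?; rewrite phase_period // /rproj sin_period cos_period. Qed.

Lemma is_derive_sin_phase omega s :
  is_derive s 1 (fun s => sin (omega * s)) (cos (omega * s) * omega).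
Proof. exact: is_derive_comp (is_derive_lin omega s) (is_derive_sin _). Qed.

Lemma is_derive_cos_phase omega s :
  is_derive s 1 (fun s => cos (omega * s)) (- sin (omega * s) * omega).
Proof. exact: is_derive_comp (is_derive_lin omega s) (is_derive_cos _). Qed.

Lemma is_derive_rproj omega s y :
  is_derive s 1 (fun s => rproj (omega * s) y)
    (- omega * (cos (omega * s) * y 0 + sin (omega * s) * y 1)).
Proof.
have := is_derive_add (is_derive_scale (- y 0) (is_derive_sin_phase omega s))
  (is_derive_scale (y 1) (is_derive_cos_phase omega s)).
rewrite (_ : - y 0 * _ + _ =
  - omega * (cos (omega * s) * y 0 + sin (omega * s) * y 1)); last by ring.
by congr is_derive; apply/funext => r; rewrite /rproj; ring.
Qed.

(** The mean of the squared projection is half the squared norm. *)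
Lemma sqr_rproj_primitive omega y : omega != 0 ->
  exists P : R -> R,
    (forall s, is_derive s 1 P (rproj (omega * s) y ^+ 2)) /\
    forall s, P (s + 2 * pi / omega) - P s = 2 * pi / omega * (sqnorm y / 2).
Proof.
move=> omega0.
exists (fun s => sqnorm y / 2 * s +
  ((y 1 ^+ 2 - y 0 ^+ 2) / (2 * omega) * (sin (omega * s) * cos (omega * s)) +
   - (y 0 * y 1) / omega * (sin (omega * s) * sin (omega * s)))).
split=> s; last first.
  rewrite phase_period // sin_period cos_period; ring.
have Ds := is_derive_sin_phase omega s; have Dc := is_derive_cos_phase omega s.
have := is_derive_add (is_derive_lin (sqnorm y / 2) s)
  (is_derive_add
    (is_derive_scale ((y 1 ^+ 2 - y 0 ^+ 2) / (2 * omega)) (is_derive_mul Ds Dc))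
    (is_derive_scale (- (y 0 * y 1) / omega) (is_derive_mul Ds Ds))).
congr is_derive; rewrite /rproj /sqnorm.
have := cos2sin2 (omega * s).
move: (cos (omega * s)) (sin (omega * s)) (y 0) (y 1) => c d a b H.
by field: H.
Qed.

End Averaging.

Section OnePeriod.
Context {R : realType}.
Implicit Types (s omega : R) (y : 'I_2 -> R).

(** Averaging one coupling term, with y frozen, over one period h. The component
    of [dir tau * g (dir tau . y)] orthogonal to y is, up to a constant factor,
    the derivative of [G (dir tau . y)] with G a primitive of g; this is
    periodic, so the mean is a multiple [w y] of y, whether or not g is odd.
    The component along y has the nonnegative integrand [q g(q)], where
    [q = dir tau . y], and the bounds on w are bounds on the integral of
    [q g(q)]. For the lower bound, [|q| >= q ^ 2 / D] replaces the modulus by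
    the square, whose mean is known. *)
Lemma averaged_coupling (g : R -> R) (L omega s0 : R) (y : 'I_2 -> R)
    (A : 'I_2 -> R -> R) : 0 < omega -> 0 <= L ->
  continuous g -> g 0 = 0 ->
  (forall s, 0 <= s * g s) -> (forall s, s * g s <= L * s ^+ 2) ->
  (forall k s, s0 <= s <= s0 + 2 * pi / omega ->
     is_derive s 1 (A k) (dir (omega * s) k * g (rproj (omega * s) y))) ->
  exists w : R, [/\ 0 <= w <= L,
    forall k, A k (s0 + 2 * pi / omega) - A k s0 = 2 * pi / omega * (w * y k) &
    forall a theta D, 0 <= a -> 0 < theta -> 0 < D ->
      (forall s, a * (`|s| - theta) <= s * g s) ->
      4 * D * theta <= sqnorm y -> sqnorm y <= D ^+ 2 -> a / (4 * D) <= w].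
Proof.
move=> omega0 L0 gC g0 gsign gL AD.
have omegaN0 : omega != 0 by rewrite gt_eqF.
set h := 2 * pi / omega.
have h0 : 0 < h by rewrite divr_gt0 // mulr_gt0 // pi_gt0.
have s0h : s0 <= s0 + h by rewrite lerDl ltW.
have [n20|n20] := eqVneq (sqnorm y) 0.
  exists 0; split=> [|k|a theta D a0 th0 D0 _]; first by rewrite lexx.
    have yE tau : rproj tau y = 0.
      apply/eqP; rewrite -sqrf_eq0 eq_le sqr_ge0 andbT.
      by rewrite -n20 sqr_rproj_le.
    have AcD s : s0 <= s <= s0 + h -> is_derive s 1 (A k) 0.
      by move=> sh; have := AD k s sh; rewrite yE g0 mulr0.
    by rewrite (derive0_cst s0h AcD) subrr mul0r mulr0.
  by rewrite n20 leNgt !mulr_gt0.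
have n2p : 0 < sqnorm y by rewrite lt_def n20 /sqnorm addr_ge0 ?sqr_ge0.
pose q s := y 0 * A 0 s + y 1 * A 1 s.
have qD s : s0 <= s <= s0 + h -> is_derive s 1 q
    (rproj (omega * s) y * g (rproj (omega * s) y)).
  move=> sh; have := is_derive_add (is_derive_scale (y 0) (AD 0 s sh))
    (is_derive_scale (y 1) (AD 1 s sh)).
  by congr is_derive; rewrite /dir /rproj /=; ring.
pose Q := q (s0 + h) - q s0.
(* The half-line on which G is a primitive contains the range of the
   projection. *)
have orth : - y 1 * (A 0 (s0 + h) - A 0 s0) + y 0 * (A 1 (s0 + h) - A 1 s0) = 0.
  have [G GD] := continuous_primitive (- (`|y 0| + `|y 1| + 1)) gC.
  have pG s : - (`|y 0| + `|y 1| + 1) < rproj (omega * s) y.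
    have := normr_dir_le1 (omega * s) 0; have := normr_dir_le1 (omega * s) 1.
    rewrite /dir /rproj /= => c1 s1.
    have : `|- sin (omega * s) * y 0| <= `|y 0| by rewrite normrM ler_piMl.
    have : `|cos (omega * s) * y 1| <= `|y 1| by rewrite normrM ler_piMl.
    rewrite !ler_norml; lra.
  pose r s := (- y 1 * A 0 s + y 0 * A 1 s) + omega^-1 * G (rproj (omega * s) y).
  have rD s : s0 <= s <= s0 + h -> is_derive s 1 r 0.
    move=> sh; have := is_derive_add
      (is_derive_add (is_derive_scale (- y 1) (AD 0 s sh))
        (is_derive_scale (y 0) (AD 1 s sh)))
      (is_derive_scale omega^-1
        (is_derive_comp (is_derive_rproj omega s y) (GD _ (pG s)))).
    by congr is_derive; rewrite /dir /=; field.
  have := derive0_cst s0h rD; rewrite /r rproj_period // => /eqP.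
  by rewrite -subr_eq0 => /eqP rE; rewrite -[RHS]rE; ring.
have AE k : A k (s0 + h) - A k s0 = Q / sqnorm y * y k.
  have E0 : (A 0 (s0 + h) - A 0 s0) * sqnorm y = Q * y 0.
    rewrite -[LHS]addr0 -(mulr0 (y 1)) -orth /Q /q /sqnorm; ring.
  have E1 : (A 1 (s0 + h) - A 1 s0) * sqnorm y = Q * y 1.
    rewrite -[LHS]addr0 -(mulr0 (- y 0)) -orth /Q /q /sqnorm; ring.
  apply: (mulIf n20); rewrite mulrAC divfK //.
  by case: k => -[|[|//]] lt_k2;
    [rewrite (_ : Ordinal _ = 0) //|rewrite (_ : Ordinal _ = 1) //]; exact: val_inj.
have Q0 : 0 <= Q.
  have := increment_le s0h (fun s _ => is_derive_cst (0 : R) s 1) qD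
    (fun s _ => gsign _).
  by rewrite subrr.
have QL : Q <= h * (sqnorm y * L).
  have lD s : s0 <= s <= s0 + h ->
      is_derive s 1 (fun s => sqnorm y * L * s) (sqnorm y * L).
    by move=> _; exact: is_derive_lin.
  apply: le_trans (increment_le s0h qD lD _) _.
    by move=> s _; apply: le_trans (gL _) _; rewrite mulrC ler_wpM2r // sqr_rproj_le.
  rewrite le_eqVlt; apply/orP; left; apply/eqP; ring.
exists (Q / (h * sqnorm y)); split.
- have hn0 : 0 < h * sqnorm y by rewrite mulr_gt0.
  rewrite divr_ge0 ?(ltW hn0) // ler_pdivrMr //= (le_trans QL) //.
  by rewrite [L * _]mulrC mulrA.
- by move=> k; rewrite AE; field; rewrite n20 gt_eqF.
move=> a theta D a0 th0 D0 glow yl yu.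
have [P [PD PE]] := sqr_rproj_primitive y omegaN0.
have lD s : s0 <= s <= s0 + h ->
    is_derive s 1 (fun s => a / D * P s + - (a * theta) * s)
      (a / D * rproj (omega * s) y ^+ 2 + - (a * theta)).
  by move=> _; exact: is_derive_add (is_derive_scale _ (PD s)) (is_derive_lin _ s).
have : a / D * (P (s0 + h) - P s0) - a * theta * h <= Q.
  have : forall s, s0 <= s <= s0 + h ->
      a / D * rproj (omega * s) y ^+ 2 + - (a * theta) <=
      rproj (omega * s) y * g (rproj (omega * s) y).
    move=> s _; apply: le_trans (glow _).
    set p := rproj _ _.
    have pD : `|p| <= D.
      rewrite -(ler_pXn2r (n := 2)) ?nnegrE ?normr_ge0 ?(ltW D0) //.
      rewrite real_normK ?num_real //.
      exact: le_trans (sqr_rproj_le _ _) yu.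
    rewrite mulrBr lerD2r -mulrA ler_wpM2l // ler_pdivrMl // -real_normK ?num_real //.
    by rewrite expr2 ler_wpM2r.
  move=> /(increment_le s0h lD qD); apply: le_trans.
  rewrite le_eqVlt; apply/orP; left; apply/eqP; ring.
rewrite PE -/h => QE.
rewrite ler_pdivlMr ?(mulr_gt0 h0 n2p) //; apply: le_trans QE.
rewrite -subr_ge0 (_ : _ - _ = a * h / (4 * D) * (sqnorm y - 4 * D * theta)).
  apply: mulr_ge0; last by rewrite subr_ge0.
  by rewrite divr_ge0 // mulr_ge0 // ltW.
by field; rewrite gt_eqF.
Qed.

End OnePeriod.

(** * Discrete consensus with errors *)

Section Consensus.
Context {R : realType} {T : finType}.
Implicit Types (e : rel T) (w : nat -> T -> T -> R) (v z : nat -> T -> R).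
Local Notation m := (#|T|%:R : R).

Lemma exists_common_bound (I : finType) (P : I -> R -> Prop) :
  (forall i a b, 0 < b -> b <= a -> P i a -> P i b) ->
  (forall i, exists2 a, 0 < a & P i a) -> exists2 a, 0 < a & forall i, P i a.
Proof.
move=> Pmon exP.
have /choice[a aP] : forall i, exists a, 0 < a /\ P i a.
  by move=> i; have [a ? ?] := exP i; exists a.
exists (\big[Num.min/1]_i a i).
  by apply: lt_bigmin => // i _; case: (aP i).
move=> i; apply: Pmon (proj2 (aP i)); last exact: bigmin_le_cond.
by apply: lt_bigmin => // k _; case: (aP k).
Qed.

Lemma exists_common_upper_bound (I : finType) (P : I -> R -> Prop) :
  (forall i a b, a <= b -> P i a -> P i b) ->
  (forall i, exists2 a, 0 < a & P i a) -> exists2 a, 0 < a & forall i, P i a.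
Proof.
move=> Pmon exP.
have [||a a0 aP] := @exists_common_bound I (fun i a => P i a^-1).
- move=> i a b b0 ba; apply: Pmon.
  by rewrite lef_pV2 ?posrE // (lt_le_trans b0).
- by move=> i; have [a a0 aP] := exP i; exists a^-1; rewrite ?invr_gt0 ?invrK.
by exists a^-1; rewrite ?invr_gt0.
Qed.

Lemma min_add_le (x y d : R) : 0 <= d -> Num.min x (y + d) <= Num.min x y + d.
Proof. by move=> d0; rewrite addr_minl le_min !ge_min lerDl d0 lexx orbT. Qed.

Definition diffusion w v n i : R := \sum_(j | j != i) w n i j * (v n j - v n i).

(** An approximate solution, measured upwards from a lower bound or downwards
    from an upper bound of its initial values, takes this one-sided form, so
    that the two ends of the range are treated by the same lemmas. *)
Definition supersolution (h W : R) w v : Prop :=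
  [/\ forall n i j, 0 <= w n i j <= W, forall i, 0 <= v 0%N i &
      forall n i, v n i + h * diffusion w v n i <= v n.+1 i].

Lemma sum_others_le (i : T) (c : R) : 0 <= c -> \sum_(k | k != i) c <= m * c.
Proof.
move=> c0; rewrite sumr_const -[X in X <= _]mulr_natl ler_wpM2r // ler_nat.
exact: max_card.
Qed.

Lemma diffusion_term_ge0 w v W n i k : 0 <= w n i k <= W ->
  (forall i, 0 <= v n i) -> 0 <= w n i k * (v n k - v n i) + W * v n i.
Proof.
move=> /andP[w0 wW] v0.
rewrite mulrBr -addrA addr_ge0 ?mulr_ge0 // addrC subr_ge0.
by rewrite ler_wpM2r.
Qed.

Lemma diffusion_ge_sum w v W n i : (forall n i j, 0 <= w n i j <= W) ->
  (forall i, 0 <= v n i) ->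
  \sum_(k | k != i) (w n i k * (v n k - v n i) + W * v n i) - m * W * v n i
    <= diffusion w v n i.
Proof.
move=> w0W v0; rewrite big_split /= -addrA gerDl subr_le0 -mulrA.
have W0 : 0 <= W by have /andP[/le_trans] := w0W n i i; exact.
by rewrite sum_others_le // mulr_ge0.
Qed.

(** As all states are nonnegative, the neighbours of i pull it down at the
    relative rate [m W] at most, which leaves the pull of a single higher
    neighbour j visible. *)
Lemma diffusion_ge w v W n i j : (forall n i j, 0 <= w n i j <= W) ->
  (forall i, 0 <= v n i) -> j != i ->
  w n i j * (v n j - v n i) - m * W * v n i <= diffusion w v n i.
Proof.
move=> w0W v0 ji; apply: le_trans (diffusion_ge_sum i w0W v0).
have W0 : 0 <= W by have /andP[/le_trans] := w0W n i i; exact.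
rewrite lerD2r (bigD1 j) //= -addrA lerDl addr_ge0 ?mulr_ge0 //.
by apply: sumr_ge0 => k _; exact: diffusion_term_ge0.
Qed.

Lemma diffusion_geN w v W n i : (forall n i j, 0 <= w n i j <= W) ->
  (forall i, 0 <= v n i) -> - (m * W * v n i) <= diffusion w v n i.
Proof.
move=> w0W v0; apply: le_trans (diffusion_ge_sum i w0W v0).
by rewrite lerDr sumr_ge0 // => k _; exact: diffusion_term_ge0.
Qed.

Lemma supersolution_decay h W w v n i : 0 <= h -> supersolution h W w v ->
  (forall i, 0 <= v n i) -> (1 - h * m * W) * v n i <= v n.+1 i.
Proof.
move=> h0 [w0W _ vS] v0; apply: le_trans (vS n i).
have := ler_wpM2l h0 (diffusion_geN i w0W v0); lra.
Qed.

Lemma supersolution_ge0 h W w v n i : 0 <= h -> h * m * W <= 1 ->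
  supersolution h W w v -> 0 <= v n i.
Proof.
move=> h0 hW vS; elim: n i => [|n IH] i; first by case: vS.
by apply: le_trans (supersolution_decay i h0 vS IH); rewrite mulr_ge0 ?subr_ge0.
Qed.

(** The height of the root r spreads along a path of nodes that listen to each
    other, in a time tau per edge.

    The root itself loses at most half of its height until T0, because nothing
    pulls it below 0. If j is at height a, a node i that listens to j is either
    at height [2 kappa a], or at distance a / 2 from j, and then the edge weight
    is at least [b = beta (a / 2)] and outweighs the downward pull when kappa is
    small; so i reaches [kappa a] in time tau. The lower bound [beta c] on
    weights deteriorates with c, hence the constants for one level are
    chosen after those for the previous level; the time tau per level is chosen
    first. *)
Lemma level_bound e (r : T) (beta : R -> R) (W tau T0 c0 : R) (l : nat) :
  (forall c, 0 < c -> 0 < beta c) -> 0 < W -> 0 < tau -> 0 < c0 ->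
  m * W * T0 <= 1 / 2 ->
  exists2 a, 0 < a & forall h w v, 0 < h -> h <= tau / 2 -> h * m * W <= 1 / 2 ->
    supersolution h W w v ->
    (forall n i j c, n%:R * h <= T0 -> e i j -> j != i -> 0 < c ->
       c <= v n j - v n i -> beta c <= w n i j) ->
    c0 <= v 0%N r ->
    forall i s n, path e i s -> last i s = r -> uniq (i :: s) -> size s = l ->
      l%:R * tau <= n%:R * h -> n%:R * h <= T0 -> a <= v n i.
Proof.
move=> beta0 W0 tau0 c00 T0W.
have m0 : 0 < m by rewrite ltr0n; apply/card_gt0P; exists r.
elim: l => [|l [a a0 IH]].
  exists (c0 / 2); first by rewrite divr_gt0.
  move=> h w v h0 htau hW vS _ vr i s n _ lst _ /size0nil s0 _ nT.
  rewrite {s}s0 /= in lst; rewrite {i}lst.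
  have vge0 k i : 0 <= v k i.
    by apply: supersolution_ge0 (ltW h0) _ vS; rewrite (le_trans hW) //; lra.
  have decay k : (1 - k%:R * (h * m * W)) * c0 <= v k r.
    elim: k => [|k IHk]; first by rewrite mul0r subr0 mul1r.
    apply: le_trans (supersolution_decay r (ltW h0) vS (vge0 k)).
    set x := h * m * W in hW IHk *.
    have x0 : 0 <= x by rewrite !mulr_ge0 // ltW.
    have x1 : 0 <= 1 - x by lra.
    apply: le_trans (ler_wpM2l x1 IHk).
    rewrite [leRHS]mulrA ler_wpM2r ?(ltW c00) // -natr1.
    have : 0 <= k%:R * x ^+ 2 by rewrite mulr_ge0 ?sqr_ge0.
    lra.
  apply: le_trans (decay n).
  have : n%:R * h * (m * W) <= T0 * (m * W) by rewrite ler_wpM2r // mulr_ge0 // ltW.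
  move=> H; rewrite mulrC ler_wpM2r ?(ltW c00) //; lra.
pose b := beta (a / 2).
have b0 : 0 < b by apply: beta0; rewrite divr_gt0.
(* The three bounds: a node below [2 kappa a] is at distance a / 2 from j; the
   downward pull takes at most half of the upward pull b * (a / 2); the
   remaining rate b * a / 4 gives a rise of kappa * a in time tau / 2. *)
pose kappa := Num.min (1 / 4) (Num.min (b / (8 * m * W)) (tau * b / 8)).
have k0 : 0 < kappa by rewrite !lt_min !divr_gt0 ?mulr_gt0.
have k1 : kappa <= 1 / 4 by rewrite ge_min lexx.
have k2 : 8 * (m * W * kappa) <= b.
  have : kappa <= b / (8 * m * W) by rewrite !ge_min lexx orbT.
  by rewrite ler_pdivlMr ?mulr_gt0 // => H; apply: le_trans H; lra.
have k3 : kappa <= tau * b / 8 by rewrite !ge_min lexx !orbT.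
exists (kappa * a); first by rewrite mulr_gt0.
move=> h w v h0 htau hW vS wbeta vr i [//|j s] n.
rewrite [path _ _ _]/= => /andP[eij js] /= lst; rewrite inE negb_or.
move=> /andP[/andP[ij _] us] [sz] ln nT.
have vge0 k x : 0 <= v k x.
  by apply: supersolution_ge0 (ltW h0) _ vS; rewrite (le_trans hW) //; lra.
have vj k : l%:R * tau <= k%:R * h -> k%:R * h <= T0 -> a <= v k j.
  exact: (IH h w v h0 htau hW vS wbeta vr j s k js lst us sz).
have rise n0 k : l%:R * tau <= n0%:R * h -> (n0 + k)%:R * h <= T0 ->
    Num.min kappa (k%:R * h * b / 4) * a <= v (n0 + k)%N i.
  move=> ln0; elim: k => [_|k IHk nkT].
    by rewrite !mul0r min_r ?mul0r // ltW.
  have hk : (n0 + k)%:R * h <= T0.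
    by apply: le_trans nkT; rewrite ler_wpM2r ?(ltW h0) // ler_nat leq_add2l.
  have {}IHk := IHk hk.
  rewrite addnS; set x := v (n0 + k)%N i in IHk.
  have [xbig|xsmall] := leP (2 * kappa * a) x.
    apply: le_trans (supersolution_decay i (ltW h0) vS (vge0 _)).
    apply: (@le_trans _ _ (kappa * a)).
      by rewrite ler_wpM2r ?(ltW a0) // ge_min lexx.
    apply: (@le_trans _ _ (1 / 2 * x)); first lra.
    by rewrite ler_wpM2r ?vge0 //; lra.
  have vja : a <= v (n0 + k)%N j.
    apply: vj => //; apply: le_trans ln0 _.
    by rewrite ler_wpM2r ?(ltW h0) // ler_nat leq_addr.
  have k1a : kappa * a <= 1 / 4 * a by rewrite ler_wpM2r // ltW.
  have gap : a / 2 <= v (n0 + k)%N j - x by lra.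
  have wb : b <= w (n0 + k)%N i j.
    by apply: wbeta hk eij _ _ gap; rewrite ?divr_gt0 // eq_sym.
  have wgap : b * (a / 2) <= w (n0 + k)%N i j * (v (n0 + k)%N j - x).
    by apply: ler_pM => //; [exact: ltW|rewrite ltW // divr_gt0].
  have [w0W _ vS2] := vS.
  apply: le_trans (vS2 _ i); rewrite -/x.
  have ji : j != i by rewrite eq_sym.
  have := diffusion_ge w0W (vge0 (n0 + k)%N) ji.
  rewrite -/x => dge.
  have mWx : m * W * x <= b * a / 4.
    apply: (@le_trans _ _ (m * W * (2 * kappa * a))).
      by rewrite ler_wpM2l ?mulr_ge0 ?ltW.
    by have := ler_wpM2r (ltW a0) k2; lra.
  have : h * (b * a / 4) <= h * diffusion w v (n0 + k) i.
    by rewrite ler_wpM2l ?(ltW h0) //; lra.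
  have : Num.min kappa (k.+1%:R * h * b / 4) * a <=
         Num.min kappa (k%:R * h * b / 4) * a + h * b / 4 * a.
    rewrite -mulrDl ler_wpM2r ?(ltW a0) // -natr1.
    have : 0 <= h * b / 4 by rewrite divr_ge0 // mulr_ge0 // ltW.
    have -> : (k%:R + 1) * h * b / 4 = k%:R * h * b / 4 + h * b / 4 by ring.
    exact: min_add_le.
  lra.
(* k steps take a time between tau / 2 and tau. *)
pose k := Num.truncn (tau / h).
have /andP[kl ku] : k%:R <= tau / h < k.+1%:R.
  by apply: truncn_itv; rewrite divr_ge0 // ltW.
have {}kl : k%:R * h <= tau by rewrite -ler_pdivlMr.
have {}ku : tau / 2 <= k%:R * h.
  have : tau < k.+1%:R * h by rewrite -ltr_pdivrMr.
  by rewrite -natr1 mulrDl mul1r; lra.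
have lk : l%:R * tau + k%:R * h <= n%:R * h.
  by apply: le_trans ln; rewrite -natr1 mulrDl mul1r lerD2l.
have kn : (k <= n)%N.
  rewrite -(@ler_nat R) -(ler_pM2r h0); apply: le_trans lk.
  by rewrite lerDr mulr_ge0 // ltW.
have := rise (n - k)%N k; rewrite subnK // natrB // mulrBl lerBrDr => /(_ lk nT).
apply: le_trans; rewrite ler_wpM2r ?(ltW a0) // le_min lexx /=.
apply: le_trans k3 _.
by have := ler_wpM2r (ltW b0) ku; lra.
Qed.

(** Simple paths to the root have length at most m, so the time [m * tau] is
    enough for all nodes. *)
Lemma root_lifts_all e (r : T) (beta : R -> R) (W tau T0 c0 : R) :
  (forall c, 0 < c -> 0 < beta c) -> 0 < W -> 0 < tau -> 0 < c0 ->
  m * W * T0 <= 1 / 2 -> (forall i, i != r -> connect e i r) ->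
  exists2 a, 0 < a & forall h w v, 0 < h -> h <= tau / 2 -> h * m * W <= 1 / 2 ->
    supersolution h W w v ->
    (forall n i j c, n%:R * h <= T0 -> e i j -> j != i -> 0 < c ->
       c <= v n j - v n i -> beta c <= w n i j) ->
    c0 <= v 0%N r ->
    forall i n, m * tau <= n%:R * h -> n%:R * h <= T0 -> a <= v n i.
Proof.
move=> beta0 W0 tau0 c00 T0W conn.
have [|l|a a0 aP] := @exists_common_bound 'I_#|T|.+1 (fun l a =>
  forall h w v, 0 < h -> h <= tau / 2 -> h * m * W <= 1 / 2 ->
    supersolution h W w v ->
    (forall n i j c, n%:R * h <= T0 -> e i j -> j != i -> 0 < c ->
       c <= v n j - v n i -> beta c <= w n i j) ->
    c0 <= v 0%N r ->
    forall i s n, path e i s -> last i s = r -> uniq (i :: s) -> size s = l ->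
      l%:R * tau <= n%:R * h -> n%:R * h <= T0 -> a <= v n i).
- move=> l a b b0 ba H h w v h0 htau hW vS wb vr i s n pis lst us sz ln nT.
  exact: le_trans ba (H h w v h0 htau hW vS wb vr i s n pis lst us sz ln nT).
- exact: level_bound.
exists a => // h w v h0 htau hW vS wb vr i n ln nT.
have [s [pis lst us]] : exists s, [/\ path e i s, last i s = r & uniq (i :: s)].
  have [->|/conn/connectP[s pis ->]] := eqVneq i r; first by exists [::].
  by have [s' ? ? _] := shortenP pis; exists s'.
have szT : (size s < #|T|.+1)%N.
  by rewrite ltnS ltnW // -[(size s).+1]/(size (i :: s)) -(card_uniqP us) max_card.
apply: (aP (Ordinal szT) h w v h0 htau hW vS wb vr i s n) => //=.
by apply: le_trans ln; rewrite ler_wpM2r ?(ltW tau0) // ler_nat -ltnS.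
Qed.

Lemma exists_argmin (f : T -> R) (i : T) : exists k, forall j, f k <= f j.
Proof.
by case: (@arg_minP _ _ T i xpredT f) => // k _ kmin; exists k => j; exact: kmin.
Qed.

Section Approximate.
Variables (h W E : R) (w : nat -> T -> T -> R) (z : nat -> T -> R).
Hypothesis w0W : forall n i j, 0 <= w n i j <= W.
Hypothesis zS : forall n i,
  `|z n.+1 i - z n i - h * diffusion w z n i| <= E * h ^+ 2.

(** Adding the sum of the error bounds turns an approximate solution into an
    exact one-sided one, seen from below or from above. *)
Lemma supersolution_below lo : (forall i, lo <= z 0%N i) ->
  supersolution h W w (fun n i => z n i - lo + n%:R * (E * h ^+ 2)).
Proof.
move=> loz; split=> // [k|n k]; first by rewrite mul0r addr0 subr_ge0.
have -> : diffusion w (fun n i => z n i - lo + n%:R * (E * h ^+ 2)) n k =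
    diffusion w z n k.
  by apply: eq_bigr => l _; congr (_ * _); ring.
have := zS n k; rewrite ler_norml -natr1 => /andP[]; lra.
Qed.

Lemma supersolution_above hi : (forall i, z 0%N i <= hi) ->
  supersolution h W w (fun n i => hi - z n i + n%:R * (E * h ^+ 2)).
Proof.
move=> zhi; split=> // [k|n k]; first by rewrite mul0r addr0 subr_ge0.
have -> : diffusion w (fun n i => hi - z n i + n%:R * (E * h ^+ 2)) n k =
    - diffusion w z n k.
  by rewrite -sumrN; apply: eq_bigr => l _; rewrite -mulrN; congr (_ * _); ring.
have := zS n k; rewrite ler_norml -natr1 => /andP[]; lra.
Qed.

Lemma spread_growth V n : 0 <= h -> h * m * W <= 1 ->
  (forall i j, z 0%N i - z 0%N j <= V) ->
  forall i j, z n i - z n j <= V + 2 * (n%:R * (E * h ^+ 2)).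
Proof.
move=> h0 hW zV i j; have [k0 k0min] := exists_argmin (z 0%N) i.
have zhi k : z 0%N k <= z 0%N k0 + V by rewrite -lerBlDl; exact: zV.
have := supersolution_ge0 n j h0 hW (supersolution_below k0min).
have := supersolution_ge0 n i h0 hW (supersolution_above zhi).
rewrite /=; lra.
Qed.

End Approximate.

(** If the root lies in the upper half of the range it lifts the lower end, and
    otherwise it lowers the upper end, by an amount a that does not depend on
    the step h; the errors, of order h * h per step, add up to a quarter of a
    at most over T0 / h steps. *)
Lemma spread_contraction e (r : T) (beta : R -> R) (W c0 : R) :
  (forall c, 0 < c -> 0 < beta c) -> 0 < W -> 0 < c0 ->
  (forall i, i != r -> connect e i r) ->
  let T0 := 1 / (2 * m * W) in
  exists2 a, 0 < a & exists2 h1, 0 < h1 & forall h E w z (V : R),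
    0 < h -> h <= h1 -> 0 <= E -> E * T0 * h <= a / 4 ->
    (forall n i j, 0 <= w n i j <= W) ->
    (forall n i, `|z n.+1 i - z n i - h * diffusion w z n i| <= E * h ^+ 2) ->
    (forall n i j c, n%:R * h <= T0 -> e i j -> j != i -> 0 < c ->
       c <= `|z n j - z n i| -> beta c <= w n i j) ->
    c0 <= V -> (forall i j, z 0%N i - z 0%N j <= V) ->
    forall i j, z (Num.truncn (T0 / h)) i - z (Num.truncn (T0 / h)) j <= V - a / 2.
Proof.
move=> beta0 W0 c00 conn T0.
have m0 : 0 < m by rewrite ltr0n; apply/card_gt0P; exists r.
have T00 : 0 < T0 by rewrite divr_gt0 // !mulr_gt0.
have T0W : m * W * T0 = 1 / 2 by rewrite /T0; field; rewrite ?gt_eqF.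
(* m levels, and one more tau to absorb the rounding of T0 / h. *)
pose tau := T0 / (m + 1).
have tau0 : 0 < tau by rewrite divr_gt0 // ltr_wpDl.
have tauE : m * tau + tau = T0.
  by rewrite /tau; field; rewrite gt_eqF // ltr_wpDl.
have T0W' : m * W * T0 <= 1 / 2 by rewrite T0W.
have c20 : 0 < c0 / 2 by rewrite divr_gt0.
have [a a0 aP] := root_lifts_all beta0 W0 tau0 c20 T0W' conn.
exists a => //.
exists (tau / 2); first by rewrite divr_gt0.
move=> h E w z V h0 hh1 E0 ETh w0W zS wb cV zV i j.
set N := Num.truncn (T0 / h).
have /andP[Nl Nu] : N%:R <= T0 / h < N.+1%:R.
  by apply: truncn_itv; rewrite divr_ge0 // ltW.
have {}Nl : N%:R * h <= T0 by rewrite -ler_pdivlMr.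
have {}Nu : m * tau <= N%:R * h.
  have : T0 < N.+1%:R * h by rewrite -ltr_pdivrMr.
  rewrite -natr1 mulrDl mul1r; lra.
have hW : h * m * W <= 1 / 2.
  have : h * (m * W) <= T0 * (m * W).
    rewrite ler_wpM2r ?(mulr_ge0 (ltW m0) (ltW W0)) //; apply: le_trans hh1 _.
    have : 0 <= m * tau by rewrite mulr_ge0 // ltW.
    lra.
  lra.
have err : N%:R * (E * h ^+ 2) <= a / 4.
  apply: le_trans ETh; rewrite [leRHS]mulrAC [leLHS](_ : _ = E * h * (N%:R * h)).
    by rewrite ler_wpM2l // mulr_ge0 // ltW.
  by rewrite expr2; ring.
have [k0 k0min] := exists_argmin (z 0%N) r.
set lo := z 0%N k0 in k0min.
have vS := supersolution_below w0W zS k0min.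
have zhi k : z 0%N k <= lo + V by rewrite -lerBlDl; exact: zV.
have vS' := supersolution_above w0W zS zhi.
have hW1 : h * m * W <= 1 by lra.
have low k : lo - N%:R * (E * h ^+ 2) <= z N k.
  by have := supersolution_ge0 N k (ltW h0) hW1 vS; rewrite /=; lra.
have up k : z N k <= lo + V + N%:R * (E * h ^+ 2).
  by have := supersolution_ge0 N k (ltW h0) hW1 vS'; rewrite /=; lra.
have [zr|zr] := leP (lo + V / 2) (z 0%N r).
  have : a <= z N j - lo + N%:R * (E * h ^+ 2).
    apply: (aP h w _ h0 hh1 hW vS) => //; last by rewrite /= mul0r; lra.
    move=> n k l c nT kl lk c_gt0 cz; apply: (wb n k l c) => //.
    by apply: le_trans cz _; apply: le_trans (ler_norm _); lra.
  have := up i; lra.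
have : a <= lo + V - z N i + N%:R * (E * h ^+ 2).
  apply: (aP h w _ h0 hh1 hW vS') => //; last by rewrite /= mul0r; lra.
  move=> n k l c nT kl lk c_gt0 cz; apply: (wb n k l c) => //.
  by rewrite distrC; apply: le_trans cz _; apply: le_trans (ler_norm _); lra.
have := low j; lra.
Qed.

End Consensus.

(** * Locally Lipschitz gains and clamping *)

Section LipschitzOnSegment.
Context {R : realType}.
Implicit Types (g : R -> R) (K s t : R).

(** Compactness yields one Lipschitz constant for all pairs at small distance;
    a longer interval is crossed in small steps. *)
Lemma lipschitz_on_segment g K : locally_lipschitz g ->
  exists2 L, 0 < L & forall s t, `|s| <= K -> `|t| <= K ->
    `|g t - g s| <= L * `|t - s|.
Proof.
move=> gL.
have /compact_near_coveringP cover := @segment_compact R (- K) K.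
(* M serves as Lipschitz constant and as inverse of the radius. *)
have : \forall M \near +oo%R, `[- K, K]%classic `<=`
    (fun s => forall u, `|u - s| < M^-1 -> `|g u - g s| <= M * `|u - s|).
  apply: cover => s _; have [U Us gU] := gL s.
  have [/= rho rho0 ballU] := Us.
  near=> s' M => u uM.
  have M0 : 0 < M by near: M; exact: nbhs_pinfty_gt.
  have s's : `|s - s'| < rho / 2.
    by near: s'; apply: cvgr_dist_lt; [exact: cvg_id|exact: divr_gt0].
  have Mrho : M^-1 <= rho / 2.
    have : (rho / 2)^-1 <= M by near: M; apply: nbhs_pinfty_ge; exact: num_real.
    by rewrite invf_ple ?posrE // divr_gt0.
  have H : M.-lipschitz_on g (globally (U `*` U)) by near: M.
  apply: (H (u, s')); split => /=; apply: ballU; rewrite /ball_ /=; last first.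
    by apply: lt_trans s's _; lra.
  rewrite distrC in uM.
  have -> : s - u = (s - s') + (s' - u) by rewrite addrA subrK.
  by apply: le_lt_trans (ler_normD _ _) _; lra.
move=> Hev.
have [M [MP M0]] := filter_ex (filterI Hev (nbhs_pinfty_gt (num_real (0 : R)))).
exists M => //.
have chain n s t : s <= t -> `|s| <= K -> `|t| <= K ->
    t - s <= n%:R * (M^-1 / 2) -> `|g t - g s| <= M * `|t - s|.
  have r0 : 0 < M^-1 / 2 by rewrite divr_gt0 // invr_gt0.
  have Min s' u : `|s'| <= K -> `|u - s'| <= M^-1 / 2 ->
      `|g u - g s'| <= M * `|u - s'|.
    move=> s'K us; apply: MP; first by rewrite /= in_itv /= -ler_norml.
    by apply: le_lt_trans us _; rewrite ltr_pdivrMr // ltr_pMr ?invr_gt0 //; lra.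
  elim: n s => [|n IH] s st sK tK.
    rewrite mul0r => ?; apply: Min => //.
    by rewrite ger0_norm ?subr_ge0 //; lra.
  rewrite -natr1 mulrDl mul1r => tsn.
  have [tl|tg] := leP (t - s) (M^-1 / 2).
    by apply: Min => //; rewrite ger0_norm ?subr_ge0.
  set q := M^-1 / 2 in r0 Min IH tsn tg *.
  have qK : `|s + q| <= K by move: sK tK; rewrite !ler_norml; lra.
  have qt : s + q <= t by lra.
  have := IH _ qt qK tK; rewrite (_ : t - (s + q) <= _) => [/(_ isT)|];
    last by lra.
  have := Min s (s + q) sK; rewrite addrAC subrr add0r ger0_norm ?(ltW r0) //.
  move=> /(_ (lexx _)).
  rewrite [`|t - (s + q)|]ger0_norm ?subr_ge0 // [`|t - s|]ger0_norm ?subr_ge0 //.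
  have -> : g t - g s = (g t - g (s + q)) + (g (s + q) - g s) by rewrite addrA subrK.
  move=> H1 H2; apply: le_trans (ler_normD _ _) _; lra.
move=> s t sK tK; wlog st : s t sK tK / s <= t => [H|].
  case: (leP s t) => [|/ltW] st; first exact: H.
  by rewrite distrC (distrC t); exact: H.
apply: (chain (Num.truncn ((t - s) / (M^-1 / 2))).+1) => //.
rewrite -ler_pdivrMr ?divr_gt0 ?invr_gt0 //.
have q0 : 0 <= (t - s) / (M^-1 / 2).
  by rewrite divr_ge0 ?subr_ge0 // divr_ge0 // invr_ge0 ltW.
by have /andP[_ /ltW] := truncn_itv q0.
Unshelve. all: by end_near. Qed.

End LipschitzOnSegment.

Section Clamp.
Context {R : realType}.
Implicit Types (g : R -> R) (K s t : R).

Definition clamp K s : R := Num.max (- K) (Num.min s K).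

Lemma normr_clamp_le K s : 0 <= K -> `|clamp K s| <= K.
Proof.
move=> K0; rewrite /clamp ler_norml le_max lexx /= ge_max ge_min lexx orbT andbT.
lra.
Qed.

Lemma clamp_id K s : `|s| <= K -> clamp K s = s.
Proof. by rewrite ler_norml /clamp => /andP[? ?]; rewrite min_l // max_r. Qed.

Lemma clamp_nonexpansive K s t : `|clamp K s - clamp K t| <= `|s - t|.
Proof.
wlog st : s t / t <= s => [H|].
  case: (leP t s) => [|/ltW] st; first exact: H.
  by rewrite distrC [in leRHS]distrC; exact: H.
rewrite (ger0_norm (_ : 0 <= s - t)) ?subr_ge0 //.
rewrite /clamp; case: (leP s K) => sK; case: (leP t K) => tK;
  case: (leP (- K) s) => ?; case: (leP (- K) t) => ?;
  try case: (leP (- K) K) => ?; rewrite ler_norml; lra.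
Qed.

Lemma normr_clamp K s : 0 <= K -> `|clamp K s| = Num.min `|s| K.
Proof.
move=> K0; case: (leP `|s| K) => sK; first by rewrite clamp_id.
have [s0|s0] := leP 0 s.
  rewrite ger0_norm // in sK.
  by rewrite /clamp min_r ?(ltW sK) // max_r ?ger0_norm //; lra.
rewrite ltr0_norm // in sK.
by rewrite /clamp min_l ?max_l ?normrN ?ger0_norm //; lra.
Qed.

Lemma mulr_clamp_gain g K s : 0 < K -> (forall t, 0 <= t * g t) ->
  s * g (clamp K s) = `|s| * `|g (clamp K s)|.
Proof.
move=> K0 gsign; rewrite -normrM ger0_norm //.
have [sK|sK] := leP `|s| K; first by rewrite clamp_id.
have := gsign (clamp K s); rewrite /clamp.
have [s0|s0] := leP 0 s.
  rewrite ger0_norm // in sK.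
  rewrite min_r ?(ltW sK) // max_r; last lra.
  by rewrite (pmulr_rge0 _ K0) => gK; rewrite mulr_ge0.
rewrite ltr0_norm // in sK.
rewrite min_l ?max_l; [|lra|lra].
by rewrite mulNr oppr_ge0 (pmulr_rle0 _ K0) => gK; rewrite mulr_le0 // ltW.
Qed.

(** Clamping the argument of a gain that is Lipschitz on [-K, K] makes it globally
    Lipschitz and bounded without losing its sign. *)
Lemma clamp_gain g K L : 0 < K -> 0 < L -> g 0 = 0 ->
  (forall s, 0 <= s * g s) ->
  (forall s t, `|s| <= K -> `|t| <= K -> `|g t - g s| <= L * `|t - s|) ->
  let gK := fun s => g (clamp K s) in
  [/\ gK 0 = 0, forall s, 0 <= s * gK s, forall s, s * gK s <= L * s ^+ 2,
      forall s, `|gK s| <= L * K &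
      forall s t, `|gK t - gK s| <= L * `|t - s|].
Proof.
move=> K0 L0 g0 gsign gL gK.
have gKL s t : `|gK t - gK s| <= L * `|t - s|.
  have cK := fun s => normr_clamp_le s (ltW K0).
  apply: le_trans (gL _ _ (cK s) (cK t)) _.
  by rewrite ler_wpM2l ?(ltW L0) // clamp_nonexpansive.
have gK0 : gK 0 = 0 by rewrite /gK clamp_id ?normr0 // ltW.
split=> // s.
- by rewrite mulr_clamp_gain // mulr_ge0.
- rewrite mulr_clamp_gain // -real_normK ?num_real // expr2 mulrCA ler_wpM2l //.
  by have := gKL 0 s; rewrite gK0 !subr0.
- have := gL 0 _ _ (normr_clamp_le s (ltW K0)); rewrite normr0 g0 !subr0.
  move=> /(_ (ltW K0)) /le_trans; apply; rewrite ler_wpM2l ?(ltW L0) //.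
  exact: normr_clamp_le (ltW K0).
Qed.

(** The class K lower bound enters through its value at the one point theta. The
    affine form of the conclusion is the one that can be averaged; below theta
    its left-hand side is not positive, and a clamped gain satisfies it
    even for arguments beyond K. *)
Lemma clamp_gain_lower g K theta : 0 < K -> 0 < theta -> theta <= K ->
  (forall s, 0 <= s * g s) -> nonzero_gain g ->
  exists2 a, 0 < a & forall s, a * (`|s| - theta) <= s * g (clamp K s).
Proof.
move=> K0 th0 thK gsign [alpha [_ alpha0 alphaI] alphag].
exists (alpha theta); first by rewrite -alpha0 alphaI.
move=> s; rewrite mulr_clamp_gain //.
have a0 : 0 < alpha theta by rewrite -alpha0 alphaI.
have [sth|sth] := leP `|s| theta.
  apply: (@le_trans _ _ 0); last by rewrite mulr_ge0.
  by rewrite mulr_ge0_le0 ?(ltW a0) // subr_le0.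
rewrite mulrC; apply: ler_pM; rewrite ?subr_ge0 ?(ltW a0) ?(ltW sth) //.
  by rewrite lerBlDr lerDl ltW.
apply: le_trans (alphag _); rewrite normr_clamp ?(ltW K0) //.
have : theta <= Num.min `|s| K by rewrite le_min (ltW sth).
by rewrite le_eqVlt => /predU1P[<-//|/(alphaI _ _ (ltW th0))/ltW].
Qed.

End Clamp.

(** * The system with bounded Lipschitz gains *)

Section PeriodStep.
Context {R : realType} {T : finType}.
Local Notation m := (#|T|%:R : R).

Definition coupling_field (G : T -> T -> R -> R) (tau : R) (x : T -> 'I_2 -> R)
    (i : T) (k : 'I_2) : R :=
  dir tau k * \sum_(j | j != i) G i j (rproj tau (fun l => x j l - x i l)).

Lemma rproj_lipschitz (tau e : R) (y y' : 'I_2 -> R) :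
  (forall k, `|y k - y' k| <= e) -> `|rproj tau y - rproj tau y'| <= 2 * e.
Proof.
move=> yy'.
have -> : rproj tau y - rproj tau y' =
    dir tau 0 * (y 0 - y' 0) + dir tau 1 * (y 1 - y' 1).
  by rewrite /rproj /dir /=; ring.
have term k : `|dir tau k * (y k - y' k)| <= e.
  by rewrite normrM; apply: le_trans (yy' k); rewrite ler_piMl ?normr_dir_le1.
by apply: le_trans (ler_normD _ _) _; have := term 0; have := term 1; lra.
Qed.

Lemma continuous_rproj (omega : R) (y : R -> 'I_2 -> R) :
  (forall k, continuous (y^~ k)) ->
  continuous (fun t : R => rproj (omega * t) (y t)).
Proof.
move=> yC t; apply: cvgD; apply: cvgM.
- by apply: cvgN; exact: is_derive_continuous (is_derive_sin_phase omega t).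
- exact: yC.
- exact: is_derive_continuous (is_derive_cos_phase omega t).
- exact: yC.
Qed.

Lemma continuous_dir (omega : R) (k : 'I_2) :
  continuous (fun t : R => dir (omega * t) k).
Proof.
move=> t; rewrite /dir; case: (k == 0).
  by apply: cvgN; exact: is_derive_continuous (is_derive_sin_phase omega t).
exact: is_derive_continuous (is_derive_cos_phase omega t).
Qed.

Lemma normr_sum_others_le (i : T) (f : T -> R) (c : R) : 0 <= c ->
  (forall j, j != i -> `|f j| <= c) -> `|\sum_(j | j != i) f j| <= m * c.
Proof.
move=> c0 fc; apply: le_trans (ler_norm_sum _ _ _) _.
by apply: le_trans (ler_sum _ fc) _; exact: sum_others_le.
Qed.

Variables (G : T -> T -> R -> R) (L M : R).
Hypothesis L0 : 0 < L.
Hypothesis M0 : 0 < M.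
Hypothesis G0 : forall i j, j != i -> G i j 0 = 0.
Hypothesis Gsign : forall i j s, j != i -> 0 <= s * G i j s.
Hypothesis Gquad : forall i j s, j != i -> s * G i j s <= L * s ^+ 2.
Hypothesis GM : forall i j s, j != i -> `|G i j s| <= M.
Hypothesis GL : forall i j s t, j != i -> `|G i j t - G i j s| <= L * `|t - s|.

Lemma coupling_field_bounded tau x i k : `|coupling_field G tau x i k| <= m * M.
Proof.
rewrite normrM -[leRHS]mul1r ler_pM ?normr_dir_le1 //.
by apply: normr_sum_others_le => [|j ji]; [exact: ltW|exact: GM].
Qed.

Lemma coupling_field_lipschitz tau x x' (e : R) :
  (forall i k, `|x i k - x' i k| <= e) ->
  forall i k, `|coupling_field G tau x i k - coupling_field G tau x' i k| <=
    4 * m * L * e.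
Proof.
move=> xx' i k; rewrite /coupling_field -mulrBr -sumrB normrM.
have e0 : 0 <= e by exact: le_trans (xx' i k).
apply: (@le_trans _ _ (1 * (m * (L * (4 * e))))); last by lra.
apply: ler_pM; rewrite ?normr_dir_le1 //.
apply: normr_sum_others_le => [|j ji]; first by rewrite !mulr_ge0 // ltW.
apply: le_trans (GL _ _ ji) _; rewrite ler_wpM2l ?(ltW L0) //.
rewrite (_ : 4 * e = 2 * (2 * e)); last by ring.
apply: rproj_lipschitz => l; have := xx' i l; have := xx' j l.
rewrite !ler_norml; lra.
Qed.

(** In one period h the state moves by [m * M * h] at most, so freezing the
    differences at time s0 in the right-hand side costs an error of order h in
    the field, and h * h in the increment. With frozen differences every
    coupling term averages to a multiple of [x_j - x_i]; the weight w is the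
    same for the two coordinates, which is why the coordinates can later be
    treated separately. *)
Lemma period_step (x : R -> T -> 'I_2 -> R) (omega s0 : R) : 0 < omega ->
  (forall (t : R) i k, 0 <= t ->
    is_derive t 1 (fun t => x t i k) (coupling_field G (omega * t) (x t) i k)) ->
  0 <= s0 -> let h := 2 * pi / omega in
  exists w : T -> T -> R, [/\ forall i j, 0 <= w i j <= L,
    forall i k, `|x (s0 + h) i k - x s0 i k -
        h * \sum_(j | j != i) w i j * (x s0 j k - x s0 i k)|
      <= 4 * m * L * (m * M) * h ^+ 2 &
    forall i j a theta D, j != i -> 0 <= a -> 0 < theta -> 0 < D ->
      (forall s, a * (`|s| - theta) <= s * G i j s) ->
      4 * D * theta <= sqnorm (fun k => x s0 j k - x s0 i k) ->
      sqnorm (fun k => x s0 j k - x s0 i k) <= D ^+ 2 -> a / (4 * D) <= w i j].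
Proof.
move=> omega0 xD s00 h.
have h0 : 0 < h by rewrite divr_gt0 // mulr_gt0 // pi_gt0.
have s0h : s0 <= s0 + h by rewrite lerDl ltW.
pose y i j k := x s0 j k - x s0 i k.
have pair (q : T * T) : exists wA : R * ('I_2 -> R -> R), q.2 != q.1 ->
  [/\ 0 <= wA.1 <= L,
    forall k (s : R), s0 <= s <= s0 + h -> is_derive s 1 (wA.2 k)
      (dir (omega * s) k * G q.1 q.2 (rproj (omega * s) (y q.1 q.2))),
    forall k, wA.2 k (s0 + h) - wA.2 k s0 = h * (wA.1 * y q.1 q.2 k) &
    forall a theta D, 0 <= a -> 0 < theta -> 0 < D ->
      (forall s, a * (`|s| - theta) <= s * G q.1 q.2 s) ->
      4 * D * theta <= sqnorm (y q.1 q.2) -> sqnorm (y q.1 q.2) <= D ^+ 2 ->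
      a / (4 * D) <= wA.1].
  case: q => i j /=; case: (boolP (j != i)) => ji; last by exists (0, fun _ _ => 0).
  have GC : continuous (G i j).
    by apply: (@lipschitz_continuous _ _ L) => s t; exact: GL.
  have /choice[A AD] k : exists A : R -> R, forall s : R, s0 <= s <= s0 + h ->
      is_derive s 1 A (dir (omega * s) k * G i j (rproj (omega * s) (y i j))).
    have fC : continuous (fun s : R => dir (omega * s) k *
        G i j (rproj (omega * s) (y i j))).
      move=> s; apply: cvgM; first exact: continuous_dir.
      apply: (@continuous_comp _ _ _
        (fun s : R => rproj (omega * s) (y i j)) (G i j)).
        by apply: continuous_rproj => l; exact: cst_continuous.
      exact: GC.
    have [A AD] := continuous_primitive (s0 - 1) fC.
    by exists A => s /andP[ss _]; apply: AD; lra.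
  have [w [w0L wA wlow]] := averaged_coupling omega0 (ltW L0) GC (G0 ji)
    (fun s => Gsign s ji) (fun s => Gquad s ji) AD.
  by exists (w, A).
have [wA wAP] := choice pair.
exists (fun i j => if j != i then (wA (i, j)).1 else 0); split.
- move=> i j; case: ifPn => ji; last by rewrite lexx ltW.
  by have [] := wAP (i, j) ji.
- move=> i k.
  pose f s := x s i k - \sum_(j | j != i) (wA (i, j)).2 k s.
  have fD (s : R) : s0 <= s <= s0 + h -> is_derive s 1 f
      (coupling_field G (omega * s) (x s) i k -
       coupling_field G (omega * s) (x s0) i k).
    move=> sh; apply: is_deriveB.
      by apply: xD; apply: le_trans s00 _; case/andP: sh.
    rewrite /coupling_field mulr_sumr; apply: is_derive_big => j ji.
    by have [_ + _ _] := wAP (i, j) ji; exact.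
  have fE : f (s0 + h) - f s0 = x (s0 + h) i k - x s0 i k -
      h * \sum_(j | j != i) (if j != i then (wA (i, j)).1 else 0) *
        (x s0 j k - x s0 i k).
    rewrite mulr_sumr /f opprD opprK addrACA; congr (_ + _).
    rewrite addrC -sumrB -sumrN; apply: eq_bigr => j ji; rewrite ji.
    by have [_ _ <- _] := wAP (i, j) ji; rewrite opprB.
  rewrite -fE; apply: le_trans (increment_normr_le_cst s0h fD _) _.
    move=> s /andP[ss sh].
    apply: (@coupling_field_lipschitz (omega * s) (x s) (x s0) (m * M * h)).
    move=> j l; apply: le_trans (@increment_normr_le_cst _ (fun s => x s j l)
      (fun s => coupling_field G (omega * s) (x s) j l) s0 s (m * M) ss _ _) _.
    - by move=> r /andP[sr _]; apply: xD; exact: le_trans s00 sr.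
    - by move=> r _; exact: coupling_field_bounded.
    - by rewrite ler_wpM2l ?mulr_ge0 // ?(ltW M0) // lerBlDl.
  rewrite addrAC subrr add0r le_eqVlt; apply/orP; left; apply/eqP; ring.
- move=> i j a theta D ji; rewrite ji.
  by have [_ _ _] := wAP (i, j) ji; exact.
Qed.

End PeriodStep.

Section BoundedSystem.
Context {R : realType} {T : finType}.
Local Notation m := (#|T|%:R : R).
Variables (G : T -> T -> R -> R) (L M : R).
Hypothesis L0 : 0 < L.
Hypothesis M0 : 0 < M.
Hypothesis G0 : forall i j, j != i -> G i j 0 = 0.
Hypothesis Gsign : forall i j s, j != i -> 0 <= s * G i j s.
Hypothesis Gquad : forall i j s, j != i -> s * G i j s <= L * s ^+ 2.
Hypothesis GM : forall i j s, j != i -> `|G i j s| <= M.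
Hypothesis GL : forall i j s t, j != i -> `|G i j t - G i j s| <= L * `|t - s|.

Definition spread_le (x : T -> 'I_2 -> R) (V : R) : Prop :=
  forall i j k, x i k - x j k <= V.

Definition coupled_solution (omega : R) (x : R -> T -> 'I_2 -> R) : Prop :=
  forall (t : R) i k, 0 <= t ->
    is_derive t 1 (fun t => x t i k) (coupling_field G (omega * t) (x t) i k).

Variables (e : rel T) (r : T).
Hypothesis e_irr : forall i j, e i j -> j != i.
Hypothesis conn : forall i, i != r -> connect e i r.
Hypothesis Ggain : forall theta, 0 < theta -> exists2 a, 0 < a &
  forall i j s, e i j -> a * (`|s| - theta) <= s * G i j s.

(** Blocks of N periods are grouped, with N h close to the time T0 of the
    contraction. Each block reduces the spread by a / 2, down to the level c0
    below which the coupling may be too weak; inside a block the sum of the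
    errors is at most c0, and inside a period two nodes move apart by another c0
    at most. All the weight bounds are valid because, by induction on the
    blocks, the spread never exceeds [D1 + c0] at the multiples of h. *)
Lemma bounded_system_contracts (D1 c0 : R) : 0 < D1 -> 0 < c0 ->
  exists2 omega0 : R, 0 < omega0 & forall omega, omega0 <= omega ->
  exists P a : R, [/\ 0 < P, 0 < a & forall x V, coupled_solution omega x ->
    c0 <= V -> V <= D1 -> spread_le (x 0) V -> forall (k : nat) t,
    k%:R * P <= t ->
    spread_le (x t) (Num.max (V - k%:R * (a / 2)) c0 + 2 * c0)].
Proof.
move=> D10 c00.
have m0 : 0 < m by rewrite ltr0n; apply/card_gt0P; exists r.
(* S bounds the spread in one coordinate, D the Euclidean distances. *)
pose S := D1 + c0; pose D := 2 * S.
have S0 : 0 < S by rewrite addr_gt0.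
have D0 : 0 < D by rewrite mulr_gt0.
have /choice[gain gainP] theta : exists a, 0 < theta -> 0 < a /\
    forall i j s, e i j -> a * (`|s| - theta) <= s * G i j s.
  have [/Ggain[a a0 aG]|th0] := ltP 0 theta; first by exists a.
  by exists 0.
(* The threshold at which the averaged lower bound applies to [|y| >= c]. *)
pose theta c := c ^+ 2 / (4 * D).
have theta0 c : 0 < c -> 0 < theta c.
  by move=> c_gt0; rewrite divr_gt0 ?exprn_gt0 ?mulr_gt0.
pose beta c := gain (theta c) / (4 * D).
have beta0 c : 0 < c -> 0 < beta c.
  by move=> /theta0/gainP[? _]; rewrite divr_gt0 ?mulr_gt0.
have [a a0 [h1 h10 contract]] := spread_contraction beta0 L0 c00 conn.
set T0 := 1 / (2 * m * L) in contract.
have T00 : 0 < T0 by rewrite divr_gt0 // !mulr_gt0.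
pose E := 4 * m * L * (m * M).
have E0 : 0 < E by rewrite !mulr_gt0.
pose hmax := Num.min (Num.min h1 T0) (Num.min (a / 4 / (E * T0))
  (Num.min (c0 / (2 * (E * T0))) (c0 / (2 * (m * M))))).
have ET0 : 0 < E * T0 by exact: mulr_gt0.
have ET20 : 0 < 2 * (E * T0) by exact: mulr_gt0.
have mM0 : 0 < 2 * (m * M) by rewrite !mulr_gt0.
have hmax0 : 0 < hmax.
  rewrite lt_min; apply/andP; split; first by rewrite lt_min h10.
  by rewrite !lt_min (divr_gt0 _ ET0) ?(divr_gt0 c00) // divr_gt0.
exists (2 * pi / hmax); first by rewrite divr_gt0 // mulr_gt0 // pi_gt0.
move=> omega omegamax.
have omega0 : 0 < omega.
  by apply: lt_le_trans omegamax; rewrite divr_gt0 // mulr_gt0 // pi_gt0.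
set h := 2 * pi / omega.
have h0 : 0 < h by rewrite divr_gt0 // mulr_gt0 // pi_gt0.
have : h <= hmax by rewrite /h ler_pdivrMr // (mulrC hmax) -ler_pdivrMr.
rewrite !le_min => /andP[/andP[hh1 hT0] /and3P[ha hc hB]].
have {}ha : E * T0 * h <= a / 4.
  by move: ha; rewrite (ler_pdivlMr _ _ ET0) mulrC.
have {}hc : 2 * (E * T0 * h) <= c0.
  by move: hc; rewrite (ler_pdivlMr _ _ ET20); lra.
have {}hB : 2 * (m * M * h) <= c0.
  by move: hB; rewrite (ler_pdivlMr _ _ mM0); lra.
have hmL : h * m * L <= 1.
  have : h * (m * L) <= T0 * (m * L) by rewrite ler_wpM2r // mulr_ge0 // ltW.
  have -> : T0 * (m * L) = 1 / 2 by rewrite /T0; field; rewrite !gt_eqF.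
  lra.
pose N := Num.truncn (T0 / h).
have N0 : (0 < N)%N by rewrite /N truncn_gt_nat ler_pdivlMr // mul1r.
have NT0 : N%:R * h <= T0.
  rewrite -ler_pdivlMr //; have T0h : 0 <= T0 / h by rewrite divr_ge0 // ltW.
  by have /andP[] := truncn_itv T0h.
exists (N%:R * h), a; split => //; first by rewrite mulr_gt0 // ltr0n.
move=> x V xS cV VD xV k t kt.
pose z k n i := x (n%:R * h) i k.
have nh0 n : 0 <= n%:R * h by rewrite mulr_ge0 // ltW.
have /choice[w wP] n := period_step L0 M0 G0 Gsign Gquad GM GL omega0 xS (nh0 n).
have w0L n i j : 0 <= w n i j <= L by have [+ _ _] := wP n; exact.
have zS l n i : `|z l n.+1 i - z l n i - h * diffusion w (z l) n i| <= E * h ^+ 2.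
  have [_ + _] := wP n => /(_ i l); rewrite -/h.
  by rewrite (_ : n%:R * h + h = n.+1%:R * h) // -natr1 mulrDl mul1r.
have wlow n i j l c : spread_le (x (n%:R * h)) S -> e i j -> 0 < c ->
    c <= `|z l n j - z l n i| -> beta c <= w n i j.
  move=> spr eij c_gt0 cz; have [_ _ +] := wP n.
  have [g0 gP] := gainP _ (theta0 c c_gt0).
  move=> /(_ i j (gain (theta c)) (theta c) D (e_irr eij) (ltW g0)).
  move=> /(_ (theta0 c c_gt0) D0).
  set y := fun _ => _; move=> H; apply: H => [s||]; first exact: gP.
    rewrite /theta mulrC divfK ?gt_eqF ?mulr_gt0 //.
    have : c ^+ 2 <= y l ^+ 2.
      by rewrite -(real_normK (num_real (y l))) ler_pXn2r ?nnegrE ?(ltW c_gt0).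
    have := sqr_ge0 (y 0); have := sqr_ge0 (y 1); rewrite /sqnorm.
    case: (l) => -[|[|//]] lt2.
      by rewrite (_ : Ordinal _ = 0); [lra|exact: val_inj].
    by rewrite (_ : Ordinal _ = 1); [lra|exact: val_inj].
  have yS k' : y k' ^+ 2 <= S ^+ 2.
    rewrite -(real_normK (num_real (y k'))) ler_pXn2r ?nnegrE ?(ltW S0) //.
    rewrite ler_norml; have := spr i j k'; have := spr j i k'; rewrite /y; lra.
  by rewrite /sqnorm /D; have := yS 0; have := yS 1; have := sqr_ge0 S; lra.
have growth n V' q : spread_le (x (n%:R * h)) V' ->
    spread_le (x ((n + q)%:R * h)) (V' + 2 * (q%:R * (E * h ^+ 2))).
  move=> spr i j l.
  have w0L' n' u v : 0 <= w (n + n')%N u v <= L by exact: w0L.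
  have zS' n' u : `|z l (n + n'.+1)%N u - z l (n + n')%N u -
      h * diffusion (fun n' => w (n + n')%N) (fun n' => z l (n + n')%N) n' u|
      <= E * h ^+ 2.
    by rewrite addnS; exact: zS.
  apply: (spread_growth (z := fun n' => z l (n + n')%N) w0L' zS' q (ltW h0) hmL).
  by move=> i' j'; rewrite addn0; exact: spr.
have short q : q%:R * h <= T0 -> 2 * (q%:R * (E * h ^+ 2)) <= c0.
  move=> qT; apply: le_trans hc; rewrite ler_wpM2l //.
  rewrite (_ : q%:R * _ = E * h * (q%:R * h)); last by rewrite expr2; ring.
  rewrite [leRHS](_ : _ = E * h * T0); last by ring.
  by rewrite ler_wpM2l // mulr_ge0 // ltW.
have block n V' : c0 <= V' -> V' <= D1 -> spread_le (x (n%:R * h)) V' ->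
    spread_le (x ((n + N)%:R * h)) (V' - a / 2).
  move=> cV' VD' spr i j l.
  have w0L' n' u v : 0 <= w (n + n')%N u v <= L by exact: w0L.
  have zS' n' u : `|z l (n + n'.+1)%N u - z l (n + n')%N u -
      h * diffusion (fun n' => w (n + n')%N) (fun n' => z l (n + n')%N) n' u|
      <= E * h ^+ 2.
    by rewrite addnS; exact: zS.
  apply: (contract h E (fun n' => w (n + n')%N) (fun n' => z l (n + n')%N) V'
    h0 hh1 (ltW E0) ha w0L' zS' _ cV').
    move=> n' i' j' c n'T eij _ c_gt0; apply: wlow eij c_gt0 => u v k'.
    apply: le_trans (growth _ _ n' spr u v k') _.
    by have := short n' n'T; rewrite /S; lra.
  by move=> i' j'; rewrite addn0; exact: spr.
have blocks q : spread_le (x ((q * N)%:R * h)) (Num.max (V - q%:R * (a / 2)) c0).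
  elim: q => [|q IH].
    by rewrite mul0n !mul0r subr0 max_l.
  have := block (q * N)%N _ _ _ IH; rewrite le_max lexx orbT => /(_ isT).
  have qa : 0 <= q%:R * (a / 2) by rewrite mulr_ge0 // divr_ge0 // ltW.
  rewrite ge_max (le_trans cV VD) (le_trans _ VD) ?lerBlDr ?lerDl // => /(_ isT).
  rewrite mulSn addnC => H i j l; apply: le_trans (H i j l) _.
  rewrite lerBlDr ge_max -[q.+1%:R]natr1 !addr_maxl !le_max.
  apply/andP; split; apply/orP; [left|right]; lra.
pose n := Num.truncn (t / h).
have t0 : 0 <= t by apply: le_trans kt; exact: mulr_ge0 (ler0n _ k) (nh0 N).
have th0 : 0 <= t / h by rewrite divr_ge0 // ltW.
have /andP[nl nu] := truncn_itv th0.
rewrite -/n ler_pdivlMr // in nl; rewrite -/n ltr_pdivrMr // in nu.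
have kq : (k <= n %/ N)%N.
  rewrite leq_divRL // /n truncn_ge_nat // ler_pdivlMr // natrM -mulrA.
  exact: kt.
have nE : n = (n %/ N * N + n %% N)%N by exact: divn_eq.
have rT : (n %% N)%:R * h <= T0.
  by apply: le_trans NT0; rewrite ler_wpM2r ?(ltW h0) // ler_nat ltnW // ltn_mod.
have xn := growth _ _ (n %% N)%N (blocks (n %/ N)%N); rewrite -nE in xn.
have move_le i l : `|x t i l - x (n%:R * h) i l| <= m * M * h.
  apply: le_trans (@increment_normr_le_cst _ (fun s => x s i l)
    (fun s => coupling_field G (omega * s) (x s) i l) _ _ (m * M) nl _ _) _.
  - by move=> s /andP[ns _]; apply: xS; exact: le_trans (nh0 n) ns.
  - by move=> s _; apply: coupling_field_bounded.
  rewrite ler_wpM2l ?mulr_ge0 // ?(ltW M0) //.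
  by move: nu; rewrite -natr1 mulrDl mul1r; lra.
move=> i j l.
have := move_le i l; have := move_le j l; have := xn i j l; have := short _ rT.
have : Num.max (V - (n %/ N)%:R * (a / 2)) c0 <= Num.max (V - k%:R * (a / 2)) c0.
  rewrite ge_max !le_max lexx orbT andbT; apply/orP; left.
  by rewrite lerD2l lerN2 ler_wpM2r ?ler_nat // divr_ge0 // ltW.
rewrite !ler_norml; lra.
Qed.

End BoundedSystem.

(** * Clamped gains in the system *)

Section CoupledODE.
Context {R : realType} {T : finType}.
Local Notation m := (#|T|%:R : R).
Implicit Types (gamma G : T -> T -> R -> R).

Lemma coupled_solution_exists G (L M omega : R) (x0 : T -> 'I_2 -> R) :
  0 < L -> 0 < M -> 0 < m ->
  (forall i j s, j != i -> `|G i j s| <= M) ->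
  (forall i j s t, j != i -> `|G i j t - G i j s| <= L * `|t - s|) ->
  exists2 x, coupled_solution G omega x & x 0 = x0.
Proof.
move=> L0 M0 m0 GM GL.
pose F (t : R) (x : T * 'I_2 -> R) (q : T * 'I_2) : R :=
  coupling_field G (omega * t) (fun i k => x (i, k)) q.1 q.2.
have [|||||u [u0 uD]] := @picard_global R (T * 'I_2)%type F (4 * m * L) (m * M)
  (fun q => x0 q.1 q.2).
- by rewrite !mulr_gt0.
- by rewrite mulr_ge0 // ltW.
- by move=> t x q; exact: coupling_field_bounded.
- move=> t x y c xy q; apply: coupling_field_lipschitz => // i k; exact: xy.
- move=> u uC [i k]; rewrite /F /= /coupling_field => t.
  apply: cvgM; first exact: continuous_dir.
  apply: cvg_big => [|j ji]; first exact: add_continuous.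
  apply: (@continuous_comp _ _ _ (fun t : R => rproj (omega * t)
    (fun l => u t (j, l) - u t (i, l))) (G i j)).
    apply: continuous_rproj => l s; apply: cvgB; exact: uC.
  by apply: (@lipschitz_continuous _ _ L) => s s'; exact: GL.
exists (fun t i k => u t (i, k)); last first.
  by apply/funext => i; apply/funext => k; exact: u0.
by move=> t i k t0; exact: uD.
Qed.

Definition clamped gamma (K : R) : T -> T -> R -> R :=
  fun i j s => gamma i j (clamp K s).

(** Projections of differences do not exceed twice the spread in one coordinate,
    so on states of small spread the clamp is invisible. *)
Lemma clamped_coupling_field gamma K tau (x : T -> 'I_2 -> R) :
  spread_le x (K / 2) ->
  coupling_field (clamped gamma K) tau x = coupling_field gamma tau x.
Proof.
move=> xK; apply/funext => i; apply/funext => k; congr (_ * _).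
apply: eq_bigr => j _; rewrite /clamped clamp_id //.
have := @rproj_lipschitz R tau (K / 2) (fun l => x j l - x i l) (fun=> 0).
have -> : rproj tau (fun=> 0) = 0 by rewrite /rproj !mulr0 addr0.
rewrite subr0 (_ : 2 * (K / 2) = K) => [|]; last by lra.
apply => l.
by rewrite subr0 ler_norml; have := xK i j l; have := xK j i l; lra.
Qed.

Lemma common_lipschitz gamma K :
  (forall i j, j != i -> locally_lipschitz (gamma i j)) ->
  exists2 L, 0 < L & forall i j s t, j != i -> `|s| <= K -> `|t| <= K ->
    `|gamma i j t - gamma i j s| <= L * `|t - s|.
Proof.
move=> gL; have [||L L0 LP] := @exists_common_upper_bound R (T * T)%type
  (fun q a => q.2 != q.1 -> forall s t, `|s| <= K -> `|t| <= K ->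
    `|gamma q.1 q.2 t - gamma q.1 q.2 s| <= a * `|t - s|).
- move=> q a b ab H ji s t sK tK; apply: le_trans (H ji s t sK tK) _.
  by rewrite ler_wpM2r.
- move=> [i j] /=; case: (boolP (j != i)) => ji; last by exists 1.
  by have [L L0 LP] := lipschitz_on_segment K (gL i j ji); exists L.
by exists L => // i j s t ji; exact: (LP (i, j)).
Qed.

Lemma clamped_gain_lower (e : rel T) gamma K : 0 < K ->
  (forall i j s, j != i -> 0 <= s * gamma i j s) ->
  (forall i j, e i j -> j != i /\ nonzero_gain (gamma i j)) ->
  forall theta, 0 < theta -> exists2 a, 0 < a &
    forall i j s, e i j -> a * (`|s| - theta) <= s * clamped gamma K i j s.
Proof.
move=> K0 gsign eP theta th0.
have [||a a0 aP] := @exists_common_bound R (T * T)%type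
  (fun q a => e q.1 q.2 -> forall s,
     a * (`|s| - theta) <= s * clamped gamma K q.1 q.2 s).
- move=> q a b b0 ba H eq s; have := H eq s.
  have [sth|sth] := leP 0 (`|s| - theta).
    by apply: le_trans; rewrite ler_wpM2r.
  move=> _; apply: (@le_trans _ _ 0); first by rewrite pmulr_rle0 // ltW.
  have [ji _] := eP _ _ eq.
  by rewrite /clamped mulr_clamp_gain // ?mulr_ge0 // => t; exact: gsign.
- move=> [i j] /=; case: (boolP (e i j)) => eij; last by exists 1.
  have [ji gn] := eP _ _ eij.
  have [mK0 mth] : 0 < Num.min theta K /\ Num.min theta K <= theta.
    by rewrite lt_min th0 K0 ge_min lexx.
  have [|a a0 aP] := clamp_gain_lower K0 mK0 _ (fun s => gsign i j s ji) gn.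
    by rewrite ge_min lexx orbT.
  exists a => // _ s; apply: le_trans (aP s).
  by rewrite ler_wpM2l ?(ltW a0) // lerD2l lerN2.
by exists a => // i j s eij; exact: (aP (i, j) eij s).
Qed.

End CoupledODE.

(** * States as matrices *)

Section Matrices.
Context {R : realType} {p : nat}.
Implicit Types (X : R -> 'M[R]_(p, 2)) (x : 'M[R]_(p, 2)).

Local Notation A := (@synchronization_manifold R p).

(** In a synchronized state y all nodes have the same coordinates, and no
    coordinate of x is farther from that of y than x is from y. *)
Lemma spread_le_euclid_dist x : spread_le x (2 * euclid_dist A x).
Proof.
move=> i j k; rewrite -ler_pdivrMl // mulrC.
apply: lb_le_inf.
  by exists (euclid_norm (x - 0)), 0 => // u v; rewrite !row0.
move=> _ [y yA <-].
have entry l : `|x l k - y l k| <= euclid_norm (x - y).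
  rewrite -sqrtr_sqr /euclid_norm ler_wsqrtr // (bigD1 l) //= (bigD1 k) //= !mxE.
  rewrite -addrA lerDl addr_ge0 //; last first.
    by apply: sumr_ge0 => u _; apply: sumr_ge0 => v _; exact: sqr_ge0.
  by apply: sumr_ge0 => v _; exact: sqr_ge0.
have yE : y i k = y j k by have /rowP/(_ k) := yA i j; rewrite !mxE.
have := entry i; have := entry j; rewrite !ler_norml yE; lra.
Qed.

Lemma euclid_dist_le_spread x (V : R) : (0 < p)%N -> 0 <= V -> spread_le x V ->
  euclid_dist A x <= 2 * p%:R * V.
Proof.
move=> p0 V0 xV; pose i0 := Ordinal p0.
pose y : 'M[R]_(p, 2) := \matrix_(i, k) x i0 k.
have yA : A y by move=> i j; apply/rowP => k; rewrite !mxE.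
apply: (@le_trans _ _ (euclid_norm (x - y))).
  apply: ge_inf; last by exists y.
  by exists 0 => _ [z _ <-]; exact: sqrtr_ge0.
have pV0 : 0 <= 2 * p%:R * V by rewrite !mulr_ge0.
rewrite -[leRHS]ger0_norm // -sqrtr_sqr ler_wsqrtr //.
apply: (@le_trans _ _ (\sum_(i < p) \sum_(k < 2) V ^+ 2)).
  apply: ler_sum => i _; apply: ler_sum => k _; rewrite !mxE.
  rewrite -(real_normK (num_real (_ - _))) ler_pXn2r ?nnegrE // ler_norml.
  by have := xV i i0 k; have := xV i0 i k; lra.
rewrite !sumr_const !card_ord.
have -> : V ^+ 2 *+ 2 *+ p = 2 * p%:R * V ^+ 2.
  by rewrite -[LHS]mulr_natl -[V ^+ 2 *+ 2]mulr_natl; ring.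
rewrite exprMn ler_wpM2r ?sqr_ge0 // expr2 ler_peMl ?mulr_ge0 //.
have : 1 <= p%:R :> R by rewrite ler1n.
lra.
Qed.

Lemma closed_synchronization_manifold : closed A.
Proof.
have -> : A = \bigcap_(q in [set: 'I_p * 'I_p * 'I_2])
    ((fun x : 'M[R]_(p, 2) => x q.1.1 q.2 - x q.1.2 q.2) @^-1` [set u | u = 0]).
  apply/seteqP; split=> x xA.
    move=> [[i j] k] _ /=; apply/eqP; rewrite subr_eq0; apply/eqP.
    by have /rowP/(_ k) := xA i j; rewrite !mxE.
  move=> i j; apply/rowP => k; rewrite !mxE.
  by apply/eqP; rewrite -subr_eq0; apply/eqP; exact: (xA (i, j, k) I).
apply: closed_bigI => q _; apply: preimage_closed; last exact: closed_eq.
move=> x _; exact: (cvgB (@coord_continuous R p 2 q.1.1 q.2 x)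
  (@coord_continuous R p 2 q.1.2 q.2 x)).
Qed.

Lemma is_derive_mxP X (D : 'M[R]_(p, 2)) (t : R) :
  is_derive t 1 X D <-> forall i k, is_derive t 1 (fun s => X s i k) (D i k).
Proof.
split=> [[XD XE] i k|XD].
  have := XD => /derivable_mxP/(_ i k) XikD; apply: (DeriveDef XikD).
  by rewrite -XE derive_mx // mxE.
have XD' : derivable X t 1 by apply/derivable_mxP => i k; case: (XD i k).
apply: (DeriveDef XD'); rewrite derive_mx //; apply/matrixP => i k; rewrite mxE.
by case: (XD i k).
Qed.

Variable gamma : 'I_p -> 'I_p -> R -> R.

Lemma oscillator_fieldE x tau :
  oscillator_field gamma x tau = \matrix_(i, k) coupling_field gamma tau x i k.
Proof.
apply/matrixP => i k; rewrite !mxE /coupling_field mulrC; congr (_ * _).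
apply: eq_bigr => j _; congr (gamma i j _).
rewrite mxE big_ord_recl big_ord1 !mxE /rproj /=.
by rewrite (_ : lift ord0 ord0 = 1); last exact: val_inj.
Qed.

Lemma solution_coord_derive omega b X (t : R) i k :
  solution_on (oscillator_field gamma) omega b X -> 0 < t -> (t%:E < b)%E ->
  is_derive t 1 (fun s => X s i k) (coupling_field gamma (omega * t) (X t) i k).
Proof.
move=> [_ _ XD] t0 tb; have /is_derive_mxP/(_ i k) := XD t t0 tb.
by rewrite oscillator_fieldE mxE.
Qed.

Lemma solution_coord_continuous omega b X (t : R) i k :
  solution_on (oscillator_field gamma) omega b X -> (t%:E < b)%E ->
  {within `[0, t], continuous (fun s => X s i k)}.
Proof.
move=> [_ XC _] tb.
have sub : `[0, t]%classic `<=` [set s : R | 0 <= s /\ (s%:E < b)%E].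
  move=> s; rewrite /= in_itv /= => /andP[s0 st]; split=> //.
  by apply: le_lt_trans tb; rewrite lee_fin.
apply: (continuous_subspaceW sub).
apply: (@within_continuous_comp _ _ _ _ X (fun M : 'M[R]_(p, 2) => M i k)) => //.
by move=> M _; exact: coord_continuous.
Qed.

Lemma solution_coord_bounded omega b X (t : R) i k :
  solution_on (oscillator_field gamma) omega b X -> 0 <= t -> (t%:E < b)%E ->
  exists2 B, 0 < B & forall s, 0 <= s <= t -> `|X s i k| <= B.
Proof.
move=> Xsol t0 tb; have XC := @solution_coord_continuous omega b X t i k Xsol tb.
have nC : {within `[0, t], continuous (fun s => `|X s i k|)}.
  by move=> s; apply: cvg_norm; exact: XC.
have [c _ cmax] := EVT_max t0 nC.
exists (`|X c i k| + 1); first by rewrite ltr_wpDl.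
by move=> s st; apply: (@le_trans _ _ `|X c i k|); [exact: cmax|rewrite lerDl].
Qed.

(** On a compact time interval both solutions are bounded, so that the gains may
    be clamped at a level K where they are Lipschitz. *)
Lemma solution_unique omega b X Y :
  (forall i j, j != i -> locally_lipschitz (gamma i j)) ->
  solution_on (oscillator_field gamma) omega b X ->
  solution_on (oscillator_field gamma) omega b Y ->
  X 0 = Y 0 -> forall t : R, 0 <= t -> (t%:E < b)%E -> X t = Y t.
Proof.
move=> gL Xsol Ysol XY0 t t0 tb.
have [||B B0 BP] := @exists_common_upper_bound R ('I_p * 'I_2)%type
  (fun q B => forall s, 0 <= s <= t -> `|X s q.1 q.2| <= B /\ `|Y s q.1 q.2| <= B).
- move=> q a c ac H s st; have [? ?] := H s st.
  by split; apply: le_trans ac.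
- move=> [i k] /=.
  have [a a0 aP] := @solution_coord_bounded omega b X t i k Xsol t0 tb.
  have [c c0 cP] := @solution_coord_bounded omega b Y t i k Ysol t0 tb.
  exists (a + c); first exact: addr_gt0.
  move=> s st; have := aP s st; have := cP s st; lra.
pose K := 4 * B.
have [L L0 LP] := common_lipschitz K gL.
have K0 : 0 <= K by rewrite mulr_ge0 // ltW.
have cL i j s s' : j != i ->
    `|clamped gamma K i j s' - clamped gamma K i j s| <= L * `|s' - s|.
  have cK := fun s => normr_clamp_le s K0.
  move=> ji; apply: le_trans (LP _ _ _ _ ji (cK s) (cK s')) _.
  by rewrite ler_wpM2l ?(ltW L0) // clamp_nonexpansive.
have small (Z : R -> 'M[R]_(p, 2)) s : (forall i k, `|Z s i k| <= B) ->
    spread_le (Z s) (K / 2).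
  move=> ZB i j k; have := ZB i k; have := ZB j k; rewrite !ler_norml /K; lra.
apply/matrixP => i k.
apply: (@ode_unique R ('I_p * 'I_2)%type (fun s q => X s q.1 q.2)
  (fun s q => Y s q.1 q.2)
  (fun s q => coupling_field gamma (omega * s) (X s) q.1 q.2)
  (fun s q => coupling_field gamma (omega * s) (Y s) q.1 q.2)
  (4 * #|'I_p|%:R * L) t _ t0 _ _ _ _ _ _ (i, k)).
- by rewrite !mulr_ge0 // ltW.
- by move=> q; exact: solution_coord_continuous Xsol tb.
- by move=> q; exact: solution_coord_continuous Ysol tb.
- move=> q s /andP[s0 st]; apply: solution_coord_derive Xsol s0 _.
  by apply: le_lt_trans tb; rewrite lee_fin ltW.
- move=> q s /andP[s0 st]; apply: solution_coord_derive Ysol s0 _.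
  by apply: le_lt_trans tb; rewrite lee_fin ltW.
- move=> q s /andP[s0 st]; have st' : 0 <= s <= t by rewrite !ltW.
  rewrite -!(@clamped_coupling_field _ _ gamma K); last first.
  + by apply: small => u v; have [] := BP (u, v) s st'.
  + by apply: small => u v; have [] := BP (u, v) s st'.
  apply: (coupling_field_lipschitz L0 cL) => u v.
  by rewrite (bigD1 (u, v)) //= lerDl sumr_ge0.
- by move=> q; rewrite XY0.
Qed.

End Matrices.

(** * Maximal solutions *)

Section MaximalSolutions.
Context {R : realType} {p : nat}.
Variable gamma : 'I_p -> 'I_p -> R -> R.
Hypothesis gammaC : connected_interconnection gamma.
Hypothesis gammaL : forall i j : 'I_p, i != j -> locally_lipschitz (gamma i j).

(** A clamped system is solved globally from the same initial state. Its solution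
    has spread at most [D1 + 2 c0 = K / 2], so it solves the original system on
    [0, +oo[ and coincides with X as long as X exists; maximality of X then
    excludes a finite escape time. *)
Lemma maximal_solution_contracts (D1 c0 : R) : 0 < D1 -> 0 < c0 -> c0 <= D1 ->
  exists2 omega0 : R, 0 < omega0 & forall omega, omega0 <= omega ->
  exists P a : R, [/\ 0 < P, 0 < a & forall b (X : R -> 'M[R]_(p, 2)) V,
    maximal_solution (oscillator_field gamma) omega b X ->
    c0 <= V -> V <= D1 -> spread_le (X 0) V -> b = +oo%E /\
    forall (k : nat) t, k%:R * P <= t ->
    spread_le (X t) (Num.max (V - k%:R * (a / 2)) c0 + 2 * c0)].
Proof.
move=> D10 c00 cD.
have [gi [r conn]] := gammaC.
pose e : rel 'I_p := interconnection_edge gamma.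
have gL i j : j != i -> locally_lipschitz (gamma i j).
  by rewrite eq_sym; exact: gammaL.
have gz i j : j != i -> gamma i j 0 = 0.
  by rewrite eq_sym => /gi[].
have gsign i j s : j != i -> 0 <= s * gamma i j s.
  by rewrite eq_sym => /gi[_ + _]; exact.
have eP i j : e i j -> j != i /\ nonzero_gain (gamma i j).
  by move=> /andP[ij /asboolP gn]; rewrite eq_sym.
pose K := 2 * (D1 + 2 * c0).
have K0 : 0 < K by rewrite mulr_gt0 // addr_gt0 // mulr_gt0.
have [L L0 LP] := common_lipschitz K gL.
pose M := L * K; have M0 : 0 < M by rewrite mulr_gt0.
pose G := clamped gamma K.
have GP i j (ji : j != i) := clamp_gain K0 L0 (gz i j ji)
  (fun s => gsign i j s ji) (fun s t => LP i j s t ji).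
have G0 i j : j != i -> G i j 0 = 0 by move=> /GP[].
have Gsign i j s : j != i -> 0 <= s * G i j s by move=> /GP[_ + _ _ _]; exact.
have Gquad i j s : j != i -> s * G i j s <= L * s ^+ 2.
  by move=> /GP[_ _ + _ _]; exact.
have GM i j s : j != i -> `|G i j s| <= M by move=> /GP[_ _ _ + _]; exact.
have GL i j s t : j != i -> `|G i j t - G i j s| <= L * `|t - s|.
  by move=> /GP[_ _ _ _ +]; exact.
have e_irr i j : e i j -> j != i by move=> /eP[].
have Ggain := clamped_gain_lower K0 gsign eP.
have [omega0 omega00 H] := bounded_system_contracts L0 M0 G0 Gsign Gquad GM GL
  e_irr conn Ggain D10 c00.
exists omega0 => // omega /H[P [a [P0 a0 {}H]]].
exists P, a; split=> // b X V [Xsol Xmax] cV VD XV.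
have p0 : 0 < #|'I_p|%:R :> R by rewrite ltr0n; apply/card_gt0P; exists r.
have [x xS x0] := coupled_solution_exists omega (fun i k => X 0 i k) L0 M0 p0 GM GL.
have xV : spread_le (x 0) V by rewrite x0.
have xcontr := H x V xS cV VD xV.
pose Y t : 'M[R]_(p, 2) := \matrix_(i, k) x t i k.
have xE t : fun_of_matrix (Y t) = x t.
  by apply/funext => i; apply/funext => k; rewrite mxE.
have YD (t : R) : 0 <= t ->
    is_derive t 1 Y (oscillator_field gamma (Y t) (omega * t)).
  move=> t0; apply/is_derive_mxP => i k; rewrite oscillator_fieldE mxE xE.
  rewrite -(@clamped_coupling_field _ _ gamma K).
    have := xS t i k t0; congr is_derive.
    by apply/funext => s; rewrite mxE.
  move=> u v l; apply: le_trans (xcontr 0%N t _ u v l) _; first by rewrite mul0r.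
  by rewrite mul0r subr0 max_l // /K; lra.
have Yoo : solution_on (oscillator_field gamma) omega +oo Y.
  split=> //; last by move=> t t0 _; apply: YD; exact: ltW.
  apply: continuous_in_subspaceT => t; rewrite inE => -[t0 _].
  by have [/derivable1_diffP/differentiable_continuous] := YD t t0.
have Yb : solution_on (oscillator_field gamma) omega b Y.
  have [b0 _ _] := Xsol; split=> //; last by move=> t t0 _; apply: YD; exact: ltW.
  apply: continuous_in_subspaceT => t; rewrite inE => -[t0 _].
  by have [/derivable1_diffP/differentiable_continuous] := YD t t0.
have YX0 : Y 0 = X 0 by apply/matrixP => i k; rewrite mxE x0.
have YX := solution_unique gL Yb Xsol YX0.
have boo : b = +oo%E by apply/esym; apply: Xmax Yoo (leey _) YX.
split=> // k t kt.
have t0 : 0 <= t by apply: le_trans kt; rewrite mulr_ge0 // ltW.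
by rewrite -YX ?boo ?ltry // xE; exact: xcontr.
Qed.

End MaximalSolutions.

Theorem theorem2 (R : realType) (p : nat) (gamma : 'I_p -> 'I_p -> R -> R)
    (gamma_connected : connected_interconnection gamma)
    (gamma_lipschitz : forall i j : 'I_p, i != j ->
       locally_lipschitz (gamma i j)) :
  semiglobally_practically_asymptotically_stable (oscillator_field gamma)
    (@synchronization_manifold R p).
Proof.
split; first exact: closed_synchronization_manifold.
move=> Delta delta Delta0 delta0.
have p0 : (0 < p)%N by case: gamma_connected => _ [[i ip] _]; exact: leq_trans ip.
(* The distance is at most C times the spread, which will end below 3 * c0. *)
pose C : R := 2 * p%:R.
have C0 : 0 < C by rewrite mulr_gt0 // ltr0n.
pose c0 := delta / (3 * C).
have C30 : 0 < 3 * C by rewrite mulr_gt0.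
have c00 : 0 < c0 by rewrite divr_gt0.
pose D1 := 2 * Delta + c0.
have D10 : 0 < D1 by rewrite addr_gt0 // mulr_gt0.
have cD : c0 <= D1 by rewrite lerDr mulr_ge0 // ltW.
have [omega0 omega00 H] :=
  maximal_solution_contracts gamma_connected gamma_lipschitz D10 c00 cD.
exists omega0 => // omega /H[P [a [P0 a0 {}H]]].
have initial (X : R -> 'M[R]_(p, 2)) u :
    euclid_dist (@synchronization_manifold R p) (X 0) <= u ->
    spread_le (X 0) (2 * u).
  move=> Xu i j k; apply: le_trans (spread_le_euclid_dist (X 0) i j k) _.
  by rewrite ler_wpM2l.
have dist3 (x : 'M[R]_(p, 2)) : spread_le x (3 * c0) ->
    euclid_dist (@synchronization_manifold R p) x <= delta.
  have c30 : 0 <= 3 * c0 by rewrite mulr_ge0 // ltW.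
  move=> /(euclid_dist_le_spread p0 c30)/le_trans; apply.
  by rewrite -/C /c0 le_eqVlt; apply/orP; left; apply/eqP; field; rewrite gt_eqF.
have start (X : R -> 'M[R]_(p, 2)) u : u < Delta ->
    euclid_dist (@synchronization_manifold R p) (X 0) <= u ->
    spread_le (X 0) D1.
  move=> uD /initial XV i j k; apply: le_trans (XV i j k) _; rewrite /D1; lra.
split.
- move=> r dr; exists (c0 / 2); first by rewrite divr_gt0.
  move=> b X Xmax X0.
  have XV : spread_le (X 0) c0.
    by move=> i j k; apply: le_trans (initial X _ X0 i j k) _; lra.
  have [boo Xs] := H b X c0 Xmax (lexx _) cD XV.
  split=> // t t0; apply: le_trans (ltW dr); apply: dist3 => i j k.
  apply: le_trans (Xs 0%N t _ i j k) _; first by rewrite mul0r.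
  rewrite mul0r subr0 maxxx; lra.
- move=> eps epsD; exists (C * (D1 + 2 * c0)).
    by rewrite mulr_gt0 // addr_gt0 // mulr_gt0.
  move=> b X Xmax /(start X _ epsD) XV.
  have [boo Xs] := H b X D1 Xmax cD (lexx _) XV.
  split=> // t t0; apply: euclid_dist_le_spread => // [|i j k].
    by lra.
  apply: le_trans (Xs 0%N t _ i j k) _; first by rewrite mul0r.
  by rewrite mul0r subr0 max_l.
move=> r eps rD deps.
pose k := (Num.truncn (D1 / (a / 2))).+1.
have kD : D1 <= k%:R * (a / 2).
  have a20 : 0 < a / 2 by rewrite divr_gt0.
  rewrite -ler_pdivrMr //.
  have q0 : 0 <= D1 / (a / 2) by rewrite divr_ge0 // ltW.
  by have /andP[_ /ltW] := truncn_itv q0.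
exists (k%:R * P); first by rewrite mulr_gt0 // ltr0n.
move=> b X Xmax /(start X _ rD) XV.
have [boo Xs] := H b X D1 Xmax cD (lexx _) XV.
split=> // t kt; apply: le_trans (ltW deps); apply: dist3 => i j l.
apply: le_trans (Xs k t kt i j l) _.
by rewrite max_r; lra.
Qed.
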